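(* For every $n\ge 1$, the homomorphism $\pi_1\,\mathcal{UR}^<_n\to\pi_1\,\mathcal{UR}_n$ induced by the inclusion $\mathcal{UR}^<_n\hookrightarrow\mathcal{UR}_n$ is injective.
   Context: A ring is a Euclidean (round) circle in $\mathbb R^3$. $\mathcal{UR}_n$ is the space of unordered configurations of $n$ disjoint, pairwise unlinked rings in $\mathbb R^3$ all lying in planes parallel to the $yz$-plane, topologized by centers and radii. $\mathcal{UR}^<_n\subset\mathcal{UR}_n$ is the subspace of configurations of rings of pairwise unequal diameters. In the paper's notation the map is $UR_n^<\to UR_n$. *)

(* Defs.v *)
From HB Require Import structures.
From mathcomp Require Import all_boot all_order all_algebra all_fingroup.
From mathcomp Require Import generic_quotient.
From mathcomp Require Import all_classical all_reals.
From mathcomp Require Import topology normedtype homotopy.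
From mathcomp Require Import ring lra.

Set Implicit Arguments.
Unset Strict Implicit.
Unset Printing Implicit Defensive.

Import Order.TTheory GRing.Theory Num.Theory.
Import numFieldNormedType.Exports.

Local Open Scope classical_set_scope.
Local Open Scope ring_scope.
Local Open Scope quotient_scope.

Section UnitInterval.
Variable R : realType.

Definition unit_interval : Type := set_type `[0 : R, 1]%classic.

HB.instance Definition _ :=
  Topological.copy unit_interval (set_type `[0 : R, 1]%classic).

Lemma clampI_subproof (t : R) :
  Num.max 0 (Num.min 1 t) \in `[0 : R, 1]%classic.
Proof.
apply/mem_set => /=; rewrite in_itv /= le_max lexx /=.
by rewrite ge_max ler01 ge_min lexx.
Qed.

Definition clampI (t : R) : unit_interval :=
  @exist R (fun x => x \in `[0, 1]%classic) _ (clampI_subproof t).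

Definition ival (t : unit_interval) : R := sval t.

Lemma ivalP t : 0 <= ival t <= 1.
Proof. by have := set_valP t; rewrite /= in_itv. Qed.

Lemma clampIE (r : R) : 0 <= r <= 1 -> ival (clampI r) = r.
Proof.
by move=> /andP[r0 r1]; rewrite /ival /= (min_idPr r1) (max_idPr r0).
Qed.

Lemma clampIK : cancel ival clampI.
Proof. by move=> t; apply: eq_sig_hprop => //=; apply: clampIE; exact: ivalP. Qed.

Lemma unit_interval_neq : clampI 0 != clampI 1.
Proof.
apply/eqP => /(congr1 ival); rewrite !clampIE ?lexx ?ler01//.
by apply/eqP; rewrite eq_sym oner_eq0.
Qed.

HB.instance Definition _ := @isBiPointed.Build unit_interval
  (clampI 0) (clampI 1) unit_interval_neq.

End UnitInterval.

Arguments ival : simpl never.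
Arguments clampI : simpl never.

Section UnitIntervalTheory.
Variable R : realType.
Local Notation I := (unit_interval R).

Lemma clampI0 : clampI 0 = zero :> I. Proof. by []. Qed.
Lemma clampI1 : clampI 1 = one :> I. Proof. by []. Qed.

Lemma ival_zero : ival (zero : I) = 0.
Proof. by rewrite -clampI0 clampIE// lexx ler01. Qed.

Lemma ival_one : ival (one : I) = 1.
Proof. by rewrite -clampI1 clampIE// lexx ler01. Qed.

Lemma continuous_ival : continuous (@ival R).
Proof. exact: (@initial_continuous I R (@ival R)). Qed.

Lemma continuous_clampI : continuous (@clampI R).
Proof.
apply: (@continuous_comp_initial I R R (@ival R)) => r /=.
apply: (@continuous_max R R (cst 0) (fun r => Num.min 1 r)); first exact: cvg_cst.
by apply: (@continuous_min R R (cst 1) id); [exact: cvg_cst|exact: cvg_id].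
Qed.

Lemma clampI_le0 (r : R) : r <= 0 -> clampI r = zero.
Proof.
move=> r0; rewrite -clampI0; apply: eq_sig_hprop => //; rewrite /clampI /=.
by rewrite (min_idPr (le_trans r0 ler01)) (min_idPr ler01) maxxx (max_idPl r0).
Qed.

Lemma clampI_ge1 (r : R) : 1 <= r -> clampI r = one.
Proof.
by move=> r1; rewrite -clampI1; apply: eq_sig_hprop => //; rewrite /clampI /= (min_idPl r1) minxx.
Qed.

Lemma continuous_if (Z X : topologicalType) (f : Z -> R) (c : R)
    (g h : Z -> X) : continuous f -> continuous g -> continuous h ->
  (forall z, f z = c -> g z = h z) ->
  continuous (fun z => if f z <= c then g z else h z).
Proof.
move=> cf cg ch gh z U /=.
suff: (nbhs (if f z <= c then g z else h z) U ->
    \forall y \near z, U (if f y <= c then g y else h y)) by [].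
case: (ltgtP (f z) c) => [fz|fz|fz] nU.
- have N : \forall y \near z, f y < c by apply: (cvgr_lt (f z)) => //; exact: cf.
  have {}nU : \forall y \near z, U (g y) by exact: (cg z).
  near=> y; rewrite ifT; first by near: y.
  by apply: ltW; near: y.
- have N : \forall y \near z, c < f y by apply: (cvgr_gt (f z)) => //; exact: cf.
  have {}nU : \forall y \near z, U (h y) by exact: (ch z).
  near=> y; rewrite ifF; first by near: y.
  by apply/negbTE; rewrite -ltNge; near: y.
- have nUg : \forall y \near z, U (g y) by exact: (cg z).
  have nUh : \forall y \near z, U (h y) by apply: (ch z); rewrite -gh.
  by near=> y; case: ifP => _; near: y.
Unshelve. all: by end_near. Qed.

Lemma continuous_compose (X Y Z : topologicalType) (f : X -> Y) (g : Y -> Z) :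
  continuous f -> continuous g -> continuous (fun x => g (f x)).
Proof. by move=> cf cg x; apply: continuous_comp; [exact: cf|exact: cg]. Qed.

Lemma continuous_pair (X Y Z : topologicalType) (f : X -> Y) (g : X -> Z) :
  continuous f -> continuous g -> continuous (fun x => (f x, g x)).
Proof. by move=> cf cg x; apply: cvg_pair; [exact: cf|exact: cg]. Qed.

Lemma continuous_clamp_affine (Z : topologicalType) (f : Z -> R) (a b : R) :
  continuous f -> continuous (fun z => clampI (a * f z + b)).
Proof.
move=> cf; apply: (@continuous_compose Z R _ (fun z => a * f z + b) (@clampI R)).
  move=> z; apply: cvgD; last exact: cvg_cst.
  by apply: cvgM; [exact: cvg_cst|exact: cf].
exact: continuous_clampI.
Qed.

Lemma continuous_ival1 (Z : topologicalType) :
  continuous (fun tz : unit_interval R * Z => ival tz.1).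
Proof.
apply: (@continuous_compose _ _ _ (@fst _ Z) (@ival R)).
  by move=> ?; exact: cvg_fst.
exact: continuous_ival.
Qed.

Lemma continuous_ival2 (Z : topologicalType) :
  continuous (fun zt : Z * unit_interval R => ival zt.2).
Proof.
apply: (@continuous_compose _ _ _ (@snd Z _) (@ival R)).
  by move=> ?; exact: cvg_snd.
exact: continuous_ival.
Qed.

End UnitIntervalTheory.

Section PathHomotopy.
Variables (R : realType) (X : topologicalType).
Local Notation I := (unit_interval R).
Implicit Types x y z : X.

(* Homotopy relative to the endpoints; the second coordinate is the parameter
   of the homotopy. *)
Definition path_homotopic x y (p q : {path I from x to y in X}) : Prop :=
  exists H : I * I -> X,
    [/\ continuous H,
        forall t, H (t, zero) = p t,
        forall t, H (t, one) = q t &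
        forall s, H (zero, s) = x /\ H (one, s) = y].

Let path_cts x y (p : {path I from x to y in X}) : continuous p.
Proof. exact: cts_fun. Qed.

Lemma path_homotopic_reparam x y (p q : {path I from x to y in X})
    (f : I -> X) (phi psi : R -> R) :
  continuous f -> continuous phi -> continuous psi ->
  phi 0 = psi 0 -> phi 1 = psi 1 ->
  (forall t, p t = f (clampI (phi (ival t)))) ->
  (forall t, q t = f (clampI (psi (ival t)))) ->
  path_homotopic p q.
Proof.
move=> cf cphi cpsi E0 E1 pE qE.
exists (fun ts => f (clampI ((1 - ival ts.2) * phi (ival ts.1)
                             + ival ts.2 * psi (ival ts.1)))); split.
- have c1 := @continuous_ival1 R I; have c2 := @continuous_ival2 R I.
  apply: (continuous_compose (g := f)) cf.
  apply: (continuous_compose (g := @clampI R)); last exact: continuous_clampI.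
  move=> ts; apply: cvgD; apply: cvgM.
  + by apply: cvgB; [exact: cvg_cst|exact: c2].
  + exact: (continuous_compose c1 cphi).
  + exact: c2.
  + exact: (continuous_compose c1 cpsi).
- by move=> t /=; rewrite ival_zero subr0 mul1r mul0r addr0 pE.
- by move=> t /=; rewrite ival_one subrr mul1r mul0r add0r qE.
- move=> s /=; rewrite ival_zero ival_one -E0 -E1 -!mulrDl subrK !mul1r.
  by rewrite -{1}ival_zero -ival_one -!pE path_zero path_one.
Qed.

Lemma path_homotopic_refl x y (p : {path I from x to y in X}) :
  path_homotopic p p.
Proof.
apply: (@path_homotopic_reparam _ _ _ _ p id id) => //.
all: by move=> t; rewrite ?clampIK//; exact: cvg_id.
Qed.

Lemma path_homotopic_sym x y (p q : {path I from x to y in X}) :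
  path_homotopic p q -> path_homotopic q p.
Proof.
move=> [H [cH H0 H1 HE]].
exists (fun ts => H (ts.1, clampI (- 1 * ival ts.2 + 1))); split => //.
- apply: (continuous_compose (g := H)) cH.
  apply: continuous_pair; first by move=> ?; exact: cvg_fst.
  exact/continuous_clamp_affine/continuous_ival2.
- by move=> t /=; rewrite ival_zero mulr0 add0r.
- by move=> t /=; rewrite ival_one mulr1 addNr.
Qed.

Lemma path_homotopic_trans x y (q p r : {path I from x to y in X}) :
  path_homotopic p q -> path_homotopic q r -> path_homotopic p r.
Proof.
move=> [H [cH H0 H1 HE]] [K [cK K0 K1 KE]].
exists (fun ts => if ival ts.2 <= 2^-1
  then H (ts.1, clampI (2 * ival ts.2 + 0))
  else K (ts.1, clampI (2 * ival ts.2 + - 1))).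
have cc a b : continuous (fun ts : I * I => (ts.1, clampI (a * ival ts.2 + b))).
  apply: continuous_pair; first by move=> ?; exact: cvg_fst.
  exact/continuous_clamp_affine/continuous_ival2.
split.
- apply: continuous_if; first exact: continuous_ival2.
  + exact: (continuous_compose (cc _ _) cH).
  + exact: (continuous_compose (cc _ _) cK).
  + by move=> ts ->; rewrite clampI_ge1 ?clampI_le0 ?H1 ?K0//; lra.
- by move=> t /=; rewrite ival_zero ifT ?clampI_le0//; lra.
- by move=> t /=; rewrite ival_one ifF ?clampI_ge1//; lra.
- by move=> s /=; case: ifP => _; [exact: HE|exact: KE].
Qed.

Section Concatenation.
Variables (x y z : X).
Variables (p : {path I from x to y in X}) (q : {path I from y to z in X}).

Definition concat_fun (t : I) : X :=
  if ival t <= 2^-1 then p (clampI (2 * ival t + 0))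
  else q (clampI (2 * ival t + - 1)).

Lemma concat_fun_continuous : continuous concat_fun.
Proof.
have cc a b := continuous_clamp_affine (a := a) (b := b) (@continuous_ival R).
apply: continuous_if.
- exact: continuous_ival.
- exact: (continuous_compose (cc _ _) (@path_cts _ _ p)).
- exact: (continuous_compose (cc _ _) (@path_cts _ _ q)).
- by move=> t ->; rewrite clampI_ge1 ?clampI_le0 ?path_one ?path_zero//; lra.
Qed.

Lemma concat_fun_zero : concat_fun zero = x.
Proof. by rewrite /concat_fun ival_zero ifT ?clampI_le0 ?path_zero//; lra. Qed.

Lemma concat_fun_one : concat_fun one = z.
Proof. by rewrite /concat_fun ival_one ifF ?clampI_ge1 ?path_one//; lra. Qed.

Definition path_concat : {path I from x to z in X} :=
  mk_path concat_fun_continuous concat_fun_zero concat_fun_one.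

End Concatenation.

Section Reversal.
Variables (x y : X) (p : {path I from x to y in X}).

Definition reverse_fun (t : I) : X := p (clampI (- 1 * ival t + 1)).

Lemma reverse_fun_continuous : continuous reverse_fun.
Proof.
apply: (continuous_compose (g := p)) (@path_cts _ _ p).
exact/continuous_clamp_affine/continuous_ival.
Qed.

Lemma reverse_fun_zero : reverse_fun zero = y.
Proof. by rewrite /reverse_fun ival_zero clampI_ge1 ?path_one//; lra. Qed.

Lemma reverse_fun_one : reverse_fun one = x.
Proof. by rewrite /reverse_fun ival_one clampI_le0 ?path_zero//; lra. Qed.

Definition path_reverse : {path I from y to x in X} :=
  mk_path reverse_fun_continuous reverse_fun_zero reverse_fun_one.

End Reversal.

Lemma path_concat_homotopic x y z (p p' : {path I from x to y in X})
    (q q' : {path I from y to z in X}) :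
  path_homotopic p p' -> path_homotopic q q' ->
  path_homotopic (path_concat p q) (path_concat p' q').
Proof.
move=> [H [cH H0 H1 HE]] [K [cK K0 K1 KE]].
exists (fun ts => if ival ts.1 <= 2^-1
  then H (clampI (2 * ival ts.1 + 0), ts.2)
  else K (clampI (2 * ival ts.1 + - 1), ts.2)).
have cc a b : continuous (fun ts : I * I => (clampI (a * ival ts.1 + b), ts.2)).
  apply: continuous_pair; last by move=> ?; exact: cvg_snd.
  exact/continuous_clamp_affine/continuous_ival1.
split.
- apply: continuous_if; first exact: continuous_ival1.
  + exact: (continuous_compose (cc _ _) cH).
  + exact: (continuous_compose (cc _ _) cK).
  + move=> ts ->; rewrite clampI_ge1 ?clampI_le0 ?(HE _).2 ?(KE _).1//; lra.
- by move=> t /=; rewrite H0 K0.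
- by move=> t /=; rewrite H1 K1.
- move=> s /=; rewrite ival_zero ival_one; split.
    by rewrite ifT ?clampI_le0 ?(HE _).1//; lra.
  by rewrite ifF ?clampI_ge1 ?(KE _).2//; lra.
Qed.

Lemma path_reverse_homotopic x y (p q : {path I from x to y in X}) :
  path_homotopic p q -> path_homotopic (path_reverse p) (path_reverse q).
Proof.
move=> [H [cH H0 H1 HE]].
exists (fun ts => H (clampI (- 1 * ival ts.1 + 1), ts.2)); split.
- apply: (continuous_compose (g := H)) cH.
  apply: continuous_pair; last by move=> ?; exact: cvg_snd.
  exact/continuous_clamp_affine/continuous_ival1.
- by move=> t /=; rewrite H0.
- by move=> t /=; rewrite H1.
- move=> s /=; rewrite ival_zero ival_one clampI_ge1 ?clampI_le0 ?(HE _).1 ?(HE _).2//; lra.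
Qed.

Let cid : continuous (@id R). Proof. by move=> t; exact: cvg_id. Qed.
Let clin (a b : R) : continuous (fun u => a * u + b).
Proof.
move=> u; apply: cvgD; last exact: cvg_cst.
by apply: cvgM; [exact: cvg_cst|exact: cvg_id].
Qed.

Lemma path_concatA x y z w (p : {path I from x to y in X})
    (q : {path I from y to z in X}) (r : {path I from z to w in X}) :
  path_homotopic (path_concat p (path_concat q r))
                 (path_concat (path_concat p q) r).
Proof.
pose psi (u : R) := if u <= 4^-1 then 2 * u + 0
  else if u <= 2^-1 then 1 * u + 4^-1 else 2^-1 * u + 2^-1.
apply: (@path_homotopic_reparam _ _ _ _ (path_concat p (path_concat q r)) id psi).
- exact: path_cts.
- exact: cid.
- apply: continuous_if => //.
  + by apply: continuous_if => // u ->; lra.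
  + by move=> u ->; rewrite ifT; lra.
- by rewrite /psi /= ifT; lra.
- by rewrite /psi /= ifF ?ifF; lra.
- by move=> t; rewrite clampIK.
move=> t; have := ivalP t; rewrite /= /mk_path/= /concat_fun/= /mk_path/= /concat_fun /psi.
set u := ival t; move=> /andP[u0 u1].
case: (leP u 2^-1) => u2; last first.
  have -> : (u <= 4^-1) = false by lra.
  rewrite (@clampIE R (2^-1 * u + 2^-1)); last lra.
  have -> : (2^-1 * u + 2^-1 <= 2^-1) = false by lra.
  rewrite (@clampIE R (2 * (2^-1 * u + 2^-1) + -1)); last lra.
  have -> : (2 * (2^-1 * u + 2^-1) + -1 <= 2^-1) = false by lra.
  by congr (r (clampI _)); lra.
rewrite (@clampIE R (2 * u + 0)); last lra.
case: (leP u 4^-1) => u4.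
  rewrite (@clampIE R (2 * u + 0)); last lra.
  by have -> : (2 * u + 0 <= 2^-1) = true by lra.
rewrite (@clampIE R (1 * u + 4^-1)); last lra.
have -> : (1 * u + 4^-1 <= 2^-1) = false by lra.
have -> : (2 * u + 0 <= 2^-1) = false by lra.
rewrite (@clampIE R (2 * (1 * u + 4^-1) + -1)); last lra.
have -> : (2 * (1 * u + 4^-1) + -1 <= 2^-1) = true by lra.
by congr (q (clampI _)); lra.
Qed.

Lemma path_concat1p x y (p : {path I from x to y in X}) :
  path_homotopic (path_concat (cst x : {path I from x to x in X}) p) p.
Proof.
apply: (@path_homotopic_reparam _ _ _ _ p (fun u => if u <= 2^-1 then 0 else 2 * u + - 1) id) => //.
- by apply: continuous_if => //; [move=> u; exact: cvg_cst|move=> u ->; lra].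
- by rewrite ifT; lra.
- by rewrite ifF; lra.
- move=> t; rewrite /= /mk_path/= /concat_fun/=.
  by case: ifP => h //; rewrite [RHS](_ : _ = p zero) ?path_zero// clampI_le0.
- by move=> t; rewrite clampIK.
Qed.

Lemma path_concatp1 x y (p : {path I from x to y in X}) :
  path_homotopic (path_concat p (cst y : {path I from y to y in X})) p.
Proof.
apply: (@path_homotopic_reparam _ _ _ _ p (fun u => if u <= 2^-1 then 2 * u + 0 else 1) id) => //.
- by apply: continuous_if => //; [move=> u; exact: cvg_cst|move=> u ->; lra].
- by rewrite ifT; lra.
- by rewrite ifF; lra.
- move=> t; rewrite /= /mk_path/= /concat_fun/=.
  by case: ifP => h //; rewrite [RHS](_ : _ = p one) ?path_one// clampI_ge1.
- by move=> t; rewrite clampIK.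
Qed.

Lemma path_concatpV x y (p : {path I from x to y in X}) :
  path_homotopic (path_concat p (path_reverse p))
                 (cst x : {path I from x to x in X}).
Proof.
apply: (@path_homotopic_reparam _ _ _ _ p
  (fun u => if u <= 2^-1 then 2 * u + 0 else - 2 * u + 2) (fun=> 0)) => //.
- by apply: continuous_if => // u ->; lra.
- by move=> u; exact: cvg_cst.
- by rewrite /= ifT; lra.
- by rewrite /= ifF; lra.
- move=> t; have := ivalP t.
  rewrite /= /mk_path/= /concat_fun/= /mk_path/= /reverse_fun/=.
  move=> /andP[t0 t1]; case: (leP (ival t) 2^-1) => // t2.
  rewrite clampIE; last by apply/andP; split; lra.
  by congr (p (clampI _)); lra.
- by move=> t; rewrite /= clampI_le0 ?path_zero.
Qed.

Lemma path_concatVp x y (p : {path I from x to y in X}) :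
  path_homotopic (path_concat (path_reverse p) p)
                 (cst y : {path I from y to y in X}).
Proof.
apply: (@path_homotopic_reparam _ _ _ _ p
  (fun u => if u <= 2^-1 then - 2 * u + 1 else 2 * u + - 1) (fun=> 1)) => //.
- by apply: continuous_if => // u ->; lra.
- by move=> u; exact: cvg_cst.
- by rewrite /= ifT; lra.
- by rewrite /= ifF; lra.
- move=> t; have := ivalP t.
  rewrite /= /mk_path/= /concat_fun/= /mk_path/= /reverse_fun/=.
  move=> /andP[t0 t1]; case: (leP (ival t) 2^-1) => // t2.
  rewrite clampIE; last by apply/andP; split; lra.
  by congr (p (clampI _)); lra.
- by move=> t; rewrite /= clampI_ge1 ?path_one.
Qed.

End PathHomotopy.

Section FundamentalGroup.
Variables (R : realType) (X : topologicalType) (x : X).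
Local Notation loop := {path (unit_interval R) from x to x in X}.

Definition loop_homotopic (p q : loop) : bool := `[< path_homotopic p q >].

Lemma loop_homotopic_equiv : equiv_class_of loop_homotopic.
Proof.
split=> [p|p q|q p r].
- exact/asboolP/path_homotopic_refl.
- by apply/asboolP/asboolP; exact: path_homotopic_sym.
- by move=> /asboolP pq /asboolP qr; exact/asboolP/(path_homotopic_trans pq qr).
Qed.

Canonical loop_homotopic_equiv_rel := EquivRelPack loop_homotopic_equiv.
Canonical loop_homotopic_enc := defaultEncModRel loop_homotopic.

Definition pi1 : Type := {eq_quot loop_homotopic}.

HB.instance Definition _ := Choice.on pi1.
HB.instance Definition _ := EqQuotient.on pi1.

Lemma pi1_eqP (p q : loop) :
  \pi_pi1 p = \pi_pi1 q <-> path_homotopic p q.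
Proof.
split=> [/eqmodP/asboolP//|pq]; exact/eqmodP/asboolP.
Qed.

Lemma pi1_reprP (p : loop) : path_homotopic (repr (\pi_pi1 p)) p.
Proof. by apply/pi1_eqP; rewrite reprK. Qed.

Definition pi1_mul (a b : pi1) : pi1 := \pi_pi1 (path_concat (repr a) (repr b)).
Definition pi1_one : pi1 := \pi_pi1 (cst x : loop).
Definition pi1_inv (a : pi1) : pi1 := \pi_pi1 (path_reverse (repr a)).

Lemma pi1_mulE (p q : loop) :
  pi1_mul (\pi_pi1 p) (\pi_pi1 q) = \pi_pi1 (path_concat p q).
Proof. by apply/pi1_eqP/path_concat_homotopic; exact: pi1_reprP. Qed.

Lemma pi1_invE (p : loop) : pi1_inv (\pi_pi1 p) = \pi_pi1 (path_reverse p).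
Proof. by apply/pi1_eqP/path_reverse_homotopic; exact: pi1_reprP. Qed.

Lemma pi1_mulA : associative pi1_mul.
Proof.
elim/quotW => p; elim/quotW => q; elim/quotW => r.
by rewrite (pi1_mulE q r) (pi1_mulE p q) 2!pi1_mulE; apply/pi1_eqP/path_concatA.
Qed.

Lemma pi1_mul1 : left_id pi1_one pi1_mul.
Proof. by elim/quotW => p; rewrite pi1_mulE; apply/pi1_eqP/path_concat1p. Qed.

Lemma pi1_mulr1 : right_id pi1_one pi1_mul.
Proof. by elim/quotW => p; rewrite pi1_mulE; apply/pi1_eqP/path_concatp1. Qed.

Lemma pi1_mulV : left_inverse pi1_one pi1_inv pi1_mul.
Proof.
by elim/quotW => p; rewrite pi1_invE pi1_mulE; apply/pi1_eqP/path_concatVp.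
Qed.

Lemma pi1_mulrV : right_inverse pi1_one pi1_inv pi1_mul.
Proof.
by elim/quotW => p; rewrite pi1_invE pi1_mulE; apply/pi1_eqP/path_concatpV.
Qed.

HB.instance Definition _ := isGroup.Build pi1
  pi1_mulA pi1_mul1 pi1_mulr1 pi1_mulV pi1_mulrV.

End FundamentalGroup.

Section InducedMap.
Variables (R : realType) (X Y : topologicalType) (f : continuousType X Y).
Local Notation I := (unit_interval R).

Definition path_image (x y : X) (p : {path I from x to y in X}) :
  {path I from f x to f y in Y} := f \o p.

Lemma path_image_homotopic (x y : X) (p q : {path I from x to y in X}) :
  path_homotopic p q -> path_homotopic (path_image p) (path_image q).
Proof.
move=> [H [cH H0 H1 HE]]; exists (f \o H); split=> /=.
- exact: (continuous_compose cH (@cts_fun _ _ f)).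
- by move=> t; rewrite H0.
- by move=> t; rewrite H1.
- by move=> s; rewrite (HE s).1 (HE s).2.
Qed.

Variable x : X.

Definition pi1_map (a : pi1 R x) : pi1 R (f x) :=
  \pi_(pi1 R (f x)) (path_image (repr a)).

Lemma pi1_mapE (p : {path I from x to x in X}) :
  pi1_map (\pi_(pi1 R x) p) = \pi_(pi1 R (f x)) (path_image p).
Proof. by apply/pi1_eqP/path_image_homotopic; exact: pi1_reprP. Qed.

Lemma pi1_map1 : pi1_map 1%g = 1%g.
Proof. by rewrite [LHS]pi1_mapE; congr (\pi_ _ _); exact/path_eqP. Qed.

Lemma pi1_mapM : {morph pi1_map : a b / (a * b)%g}.
Proof.
elim/quotW => p; elim/quotW => q.
rewrite [(_ * _)%g in LHS]pi1_mulE !pi1_mapE [RHS]pi1_mulE.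
congr (\pi_ _ _); apply/path_eqP => t.
by rewrite /= /mk_path /= /concat_fun /=; case: ifP.
Qed.

HB.instance Definition _ :=
  isMultiplicative.Build (pi1 R x) (pi1 R (f x)) pi1_map pi1_mapM.
HB.instance Definition _ :=
  Multiplicative_isUMagmaMorphism.Build (pi1 R x) (pi1 R (f x)) pi1_map
    pi1_map1.

End InducedMap.

Arguments pi1_map R {X Y} f x a.

Section Subspace.
Variables (X : topologicalType) (A : set X).

Definition subspace_incl (a : set_type A) : X := set_val a.

Lemma subspace_incl_continuous : continuous subspace_incl.
Proof. exact: (@initial_continuous (set_type A) X set_val). Qed.

HB.instance Definition _ :=
  isContinuous.Build (set_type A) X subspace_incl subspace_incl_continuous.

End Subspace.

Section Rings.
Variable R : realType.

Definition closed_disc : set (R * R) :=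
  [set z | z.1 ^+ 2 + z.2 ^+ 2 <= 1].

Definition unit_circle : set (R * R) :=
  [set z | z.1 ^+ 2 + z.2 ^+ 2 = 1].

Definition bounds_disc (C D : set 'rV[R]_3) : Prop :=
  exists g : R * R -> 'rV[R]_3,
    [/\ {within closed_disc, continuous g}, set_inj closed_disc g,
        g @` unit_circle = C & g @` closed_disc = D].

(* The link formed by C and C' is trivial: its components bound disjoint
   embedded discs. *)
Definition unlinked (C C' : set 'rV[R]_3) : Prop :=
  exists D D' : set 'rV[R]_3,
    [/\ bounds_disc C D, bounds_disc C' D' & D `&` D' = set0].

(* The Euclidean circle with centre a.1 and radius a.2 in the plane through its
   centre parallel to the yz-plane; the coordinate of index 0 is x. *)
Definition yz_ring (a : 'rV[R]_3 * R) : set 'rV[R]_3 :=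
  [set p | p 0 0 = a.1 0 0 /\ \sum_(i < 3) (p 0 i - a.1 0 i) ^+ 2 = a.2 ^+ 2].

Variable n : nat.

Definition ordered_UR_set :
    set (prod_topology (fun _ : 'I_n => ('rV[R]_3 * R)%type)) :=
  [set c | (forall i, 0 < (c i).2) /\
    forall i j, i != j ->
      yz_ring (c i) `&` yz_ring (c j) = set0 /\
      unlinked (yz_ring (c i)) (yz_ring (c j))].

Definition ordered_UR : Type := set_type ordered_UR_set.
HB.instance Definition _ :=
  Topological.copy ordered_UR (set_type ordered_UR_set).

Definition ring_at (c : ordered_UR) (i : 'I_n) : 'rV[R]_3 * R := set_val c i.

(* An unordered configuration is an ordered one up to relabelling, in the
   quotient topology. Distinct rings of a configuration are disjoint, so they
   have distinct parameters. *)
Definition same_rings (c d : ordered_UR) : bool :=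
  `[< exists s : 'S_n, forall i, ring_at d i = ring_at c (s i) >].

Lemma same_rings_equiv : equiv_class_of same_rings.
Proof.
have sym c d : same_rings c d -> same_rings d c.
  move=> /asboolP[s cd]; apply/asboolP; exists (s^-1)%g => i.
  by rewrite cd permKV.
split=> [c|c d|d c e].
- by apply/asboolP; exists 1%g => i; rewrite perm1.
- by apply/idP/idP; exact: sym.
- move=> /asboolP[s cd] /asboolP[t de]; apply/asboolP; exists (t * s)%g => i.
  by rewrite de cd permM.
Qed.

Canonical same_rings_equiv_rel := EquivRelPack same_rings_equiv.
Canonical same_rings_enc := defaultEncModRel same_rings.

Definition UR : Type := quotient_topology {eq_quot same_rings}.
HB.instance Definition _ :=
  Topological.copy UR (quotient_topology {eq_quot same_rings}).
HB.instance Definition _ :=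
  Quotient.copy UR (quotient_topology {eq_quot same_rings}).

Definition UR_lt_set : set UR :=
  [set u | exists2 c : ordered_UR, \pi_UR c = u &
    injective (fun i => 2 * (ring_at c i).2)].

Definition UR_lt : Type := set_type UR_lt_set.
HB.instance Definition _ := Topological.copy UR_lt (set_type UR_lt_set).

Definition UR_lt_incl : continuousType UR_lt UR := @subspace_incl UR UR_lt_set.

End Rings.

(* Main.v *)
(* Lift a null-homotopy in UR_n of a loop in UR^<_n to ordered configurations,
   the labels being the order of the radii along the loop, and argue by induction
   on n, forgetting the smallest ring.  The other rings give a disc in UR_{n-1}
   and, by induction, another disc G in UR^<_{n-1} with the same boundary, hence a
   sphere of configurations.  A point marked on the smallest ring avoids all the
   other rings, also over the first disc, where the ring need not be smallest.
   Over the boundary, shrink the ring to this point and transport it along the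
   meridians to the north pole of the sphere, the centre of G.  The resulting loop
   in the complement of a fixed configuration is contracted by letting the meridian
   start from points of the first disc closer and closer to the south pole, where
   the marked point is a single point q, and by finally moving q to infinity,
   where transport is the identity.  So the marked point extends over G; a small
   ring around it extends the loop to a disc in UR^<_n. *)
Require Import Defs.
From mathcomp Require Import all_boot all_order all_algebra all_fingroup.
From mathcomp Require Import generic_quotient.
From mathcomp Require Import all_classical all_reals.
From mathcomp Require Import topology normedtype derive realfun homotopy.
From mathcomp Require Import ring lra.

Set Implicit Arguments.
Unset Strict Implicit.
Unset Printing Implicit Defensive.

Import Order.TTheory GRing.Theory Num.Theory.
Import numFieldNormedType.Exports.

Local Open Scope classical_set_scope.
Local Open Scope ring_scope.
Local Open Scope quotient_scope.

(** * Continuity and compactness *)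

(** Ordering by size matters because the flat disc of a ring misses every larger ring disjoint from
    it: circles in one plane that do not meet are nested or side by side. So the smallest ring can
    be shrunk inside its own disc without hitting anything. The marked point lies on the ring and
    not at its centre, because over the first disc another ring may pass through the centre, but
    never through a point of the ring itself. The obstruction to extending the marked point over [G]
    is the image of the sphere under a connecting map, from the second homotopy group of the
    configurations to the fundamental group of the complement of one of them. It vanishes because
    far points give a section that transport fixes. The construction moves base points, so the
    induction is about free homotopies; a freely null-homotopic loop is null-homotopic. Transport is
    a finite composition of explicit maps instead of the flow of a vector field: what matters is
    that it is continuous, avoids the rings, is the identity far away and over a trivial time
    interval, and depends on the path of configurations alone. *)

Section ContinuousRealFunctions.
Variables (R : realType) (Z : topologicalType).
Implicit Types (f g : Z -> R).

Lemma cts_add f g : continuous f -> continuous g ->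
  continuous (fun z => f z + g z).
Proof. by move=> cf cg z; apply: cvgD; [exact: cf|exact: cg]. Qed.

Lemma cts_opp f : continuous f -> continuous (fun z => - f z).
Proof. by move=> cf z; apply: cvgN; exact: cf. Qed.

Lemma cts_mul f g : continuous f -> continuous g ->
  continuous (fun z => f z * g z).
Proof. by move=> cf cg z; apply: cvgM; [exact: cf|exact: cg]. Qed.

Lemma cts_inv f : continuous f -> (forall z, f z != 0) ->
  continuous (fun z => (f z)^-1).
Proof. by move=> cf f0 z; apply: cvgV; [exact: f0|exact: cf]. Qed.

Lemma cts_exp f n : continuous f -> continuous (fun z => f z ^+ n).
Proof.
move=> cf; elim: n => [|n IH]; first by move=> z; exact: cvg_cst.
by under [fun _ => _]eq_fun do rewrite exprS; exact: cts_mul.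
Qed.

Lemma cts_norm f : continuous f -> continuous (fun z => `|f z|).
Proof. by move=> cf z; apply: cvg_norm; exact: cf. Qed.

Lemma cts_max f g : continuous f -> continuous g ->
  continuous (fun z => Num.max (f z) (g z)).
Proof. by move=> cf cg z; apply: (@continuous_max R Z f g); [exact: cf|exact: cg]. Qed.

Lemma cts_min f g : continuous f -> continuous g ->
  continuous (fun z => Num.min (f z) (g z)).
Proof. by move=> cf cg z; apply: (@continuous_min R Z f g); [exact: cf|exact: cg]. Qed.

Lemma cts_sqrt f : continuous f -> continuous (fun z => Num.sqrt (f z)).
Proof. by move=> cf; apply: (continuous_compose cf); exact: sqrt_continuous. Qed.

Lemma cts_sum n (F : 'I_n -> Z -> R) : (forall i, continuous (F i)) ->
  continuous (fun z => \sum_i F i z).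
Proof.
elim: n F => [|n IH] F cF.
  by under [fun _ => _]eq_fun do rewrite big_ord0; move=> z; exact: cvg_cst.
under [fun _ => _]eq_fun do rewrite big_ord_recl.
by apply: cts_add => //; exact: IH.
Qed.

End ContinuousRealFunctions.

Lemma cts_cst (Z X : topologicalType) (x : X) : continuous (fun _ : Z => x).
Proof. by move=> z; exact: cvg_cst. Qed.

Lemma cts_id (Z : topologicalType) : continuous (fun z : Z => z).
Proof. by move=> z; exact: cvg_id. Qed.

Lemma cts_fst (Z X Y : topologicalType) (f : Z -> X * Y) :
  continuous f -> continuous (fun z => (f z).1).
Proof. by move=> cf; apply: (continuous_compose cf) => x; exact: cvg_fst. Qed.

Lemma cts_snd (Z X Y : topologicalType) (f : Z -> X * Y) :
  continuous f -> continuous (fun z => (f z).2).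
Proof. by move=> cf; apply: (continuous_compose cf) => x; exact: cvg_snd. Qed.

Ltac cts :=
  lazymatch goal with
  | |- continuous (fun z => z) => exact: cts_id
  | |- continuous (fun _ => ?x) => exact: cts_cst
  | |- continuous (fun z => @GRing.add _ (@?f z) (@?g z)) =>
      apply: (@cts_add _ _ f g); cts
  | |- continuous (fun z => @GRing.opp _ (@?f z)) => apply: (@cts_opp _ _ f); cts
  | |- continuous (fun z => @GRing.mul _ (@?f z) (@?g z)) =>
      apply: (@cts_mul _ _ f g); cts
  | |- continuous (fun z => @GRing.exp _ (@?f z) ?n) =>
      apply: (@cts_exp _ _ f n); cts
  | |- continuous (fun z => `|@?f z|) => apply: (@cts_norm _ _ f); cts
  | |- continuous (fun z => Num.max (@?f z) (@?g z)) =>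
      apply: (@cts_max _ _ f g); cts
  | |- continuous (fun z => Num.min (@?f z) (@?g z)) =>
      apply: (@cts_min _ _ f g); cts
  | |- continuous (fun z => Num.sqrt (@?f z)) => apply: (@cts_sqrt _ _ f); cts
  | |- continuous (fun z => (@?f z, @?g z)) =>
      apply: (@continuous_pair _ _ _ f g); cts
  | |- continuous (fun z => fst (@?f z)) => apply: (@cts_fst _ _ _ f); cts
  | |- continuous (fun z => snd (@?f z)) => apply: (@cts_snd _ _ _ f); cts
  | |- continuous (@fst _ _) => exact: (cts_fst (@cts_id _))
  | |- continuous (@snd _ _) => exact: (cts_snd (@cts_id _))
  | |- _ => try assumption
  end.

Section Compactness.
Variable R : realType.

Lemma compact_pos_lbound (T : topologicalType) (K : set T) (f : T -> R) :
  compact K -> continuous f -> (forall x, K x -> 0 < f x) ->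
  exists2 mu : R, 0 < mu & forall x, K x -> mu <= f x.
Proof.
move=> cK cf f0; have [->|/set0P K0] := eqVneq K set0.
  by exists 1 => // x [].
have [|c /[!inE] Kc fc] := compact_EVT_min K0 cK (f := f).
  exact: continuous_subspaceT.
by exists (f c); [exact: f0|move=> x Kx; apply: fc; rewrite inE].
Qed.

(** The Lebesgue number of a cover by balls on which [P] holds pairwise. It yields both the uniform
    continuity of the rings and the uniform lifting to ordered configurations. *)
Lemma lebesgue_number (M : pseudoMetricType R) (K : set M)
    (P : M -> M -> Prop) : compact K ->
  (forall x, K x -> exists2 d : R, 0 < d &
     forall y z, ball x d y -> ball x d z -> P y z) ->
  exists2 d : R, 0 < d & forall y z, K y -> ball y d z -> P y z.
Proof.
move=> /compact_near_coveringP cK loc.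
have [|d d0 dP] := (@nbhs_ballP _ _ _ _).1
    (cK R (nbhs (0 : R)) (fun d y => forall z, ball y d z -> P y z) _ _).
  move=> x Kx; have [d d0 dP] := loc x Kx.
  exists (ball x (d / 2), ball (0 : R) (d / 2)) => /=.
    by split; apply: nbhsx_ballx; rewrite divr_gt0.
  move=> [y e] /= [xy]; rewrite /ball/= sub0r normrN => ed z yz.
  have xz : ball x d z.
    apply: le_ball (ball_triangle xy yz).
    by rewrite [leRHS]splitr lerD2l (le_trans (ler_norm _)) ?ltW.
  by apply: dP => //; apply: le_ball xy; rewrite ler_pdivrMr // ler_peMr ?ltW // ltr1n.
have d20 : ball (0 : R) d (d / 2).
  by rewrite /ball/= sub0r normrN gtr0_norm ?divr_gt0 // ltr_pdivrMr // ltr_pMr // ltr1n.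
exists (d / 2); first exact: divr_gt0.
by move=> y z Ky; exact: (dP _ d20 y Ky).
Qed.

(** Stands in for minima over finitely many rings: each property is asked for all small [t], so the
    least of the thresholds serves every index. *)
Lemma min_threshold (n : nat) (P : nat -> R -> Prop) :
  (forall i, (i < n)%N -> exists2 e, 0 < e & forall t, 0 < t -> t <= e -> P i t) ->
  exists2 e, 0 < e & forall i t, (i < n)%N -> 0 < t -> t <= e -> P i t.
Proof.
elim: n => [|n IH] h; first by exists 1.
have [|e e0 eP] := IH; first by move=> i ni; apply: h; rewrite ltnS ltnW.
have [e' e'0 e'P] := h n (ltnSn n).
exists (Num.min e e'); first by rewrite lt_min e0 e'0.
move=> i t; rewrite ltnS leq_eqVlt le_min => /orP[/eqP->|ni] t0 /andP[te te'].
  exact: e'P.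
exact: eP.
Qed.

End Compactness.

(** * Geometry of rings *)

Section PlaneNorm.
Variable R : realType.
Implicit Types a b c d k : R.

Definition nrm2 a b : R := Num.sqrt (a ^+ 2 + b ^+ 2).

Lemma nrm2_ge0 a b : 0 <= nrm2 a b. Proof. exact: sqrtr_ge0. Qed.

Lemma nrm2_sq a b : nrm2 a b ^+ 2 = a ^+ 2 + b ^+ 2.
Proof. by rewrite sqr_sqrtr // addr_ge0 // sqr_ge0. Qed.

Lemma nrm2_le a b r : 0 <= r -> (nrm2 a b <= r) = (a ^+ 2 + b ^+ 2 <= r ^+ 2).
Proof. by move=> r0; rewrite -nrm2_sq ler_pXn2r ?nnegrE ?nrm2_ge0. Qed.

Lemma nrm2_eq a b r : 0 <= r -> (nrm2 a b = r) <-> (a ^+ 2 + b ^+ 2 = r ^+ 2).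
Proof.
move=> r0; rewrite -nrm2_sq; split=> [->//|/eqP].
by rewrite eqrXn2 ?nrm2_ge0 // => /eqP.
Qed.

Lemma nrm2D a b c d : nrm2 (a + c) (b + d) <= nrm2 a b + nrm2 c d.
Proof.
rewrite nrm2_le ?addr_ge0 ?nrm2_ge0 // !sqrrD !nrm2_sq.
suff : a * c + b * d <= nrm2 a b * nrm2 c d by lra.
apply: (le_trans (ler_norm _)).
rewrite -(@ler_pXn2r _ 2) ?nnegrE ?mulr_ge0 ?nrm2_ge0 // exprMn !nrm2_sq.
rewrite real_normK ?num_real //; rewrite -subr_ge0.
by rewrite (_ : _ - _ = (a * d - b * c) ^+ 2) ?sqr_ge0 //; ring.
Qed.

Lemma nrm2_le_abs a b : nrm2 a b <= `|a| + `|b|.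
Proof.
rewrite nrm2_le ?addr_ge0 // sqrrD !real_normK ?num_real //.
by rewrite addrAC lerDl mulrn_wge0 // mulr_ge0.
Qed.

Lemma abs_le_nrm2 a b : `|a| <= nrm2 a b.
Proof. by rewrite -sqrtr_sqr ler_wsqrtr // lerDl sqr_ge0. Qed.

Lemma nrm2C a b : nrm2 a b = nrm2 b a.
Proof. by rewrite /nrm2 addrC. Qed.

Lemma nrm2_lip a b c d : nrm2 a b <= nrm2 c d + (`|a - c| + `|b - d|).
Proof.
have := nrm2D (a - c) (b - d) c d; rewrite !subrK.
by have := nrm2_le_abs (a - c) (b - d); lra.
Qed.

End PlaneNorm.

Section RingGeometry.
Variable R : realType.

(* A point is ((x, y), z) and a ring is (centre, radius). *)
Definition point := (R * R * R)%type.
Definition ring := (point * R)%type.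
Implicit Types (w : point) (c : ring).

Definition on_ring c w : Prop :=
  w.1.1 = c.1.1.1 /\ (w.1.2 - c.1.1.2) ^+ 2 + (w.2 - c.1.2) ^+ 2 = c.2 ^+ 2.

Definition in_disc c w : Prop :=
  w.1.1 = c.1.1.1 /\ (w.1.2 - c.1.1.2) ^+ 2 + (w.2 - c.1.2) ^+ 2 <= c.2 ^+ 2.

(* Vanishes exactly on the ring, when the radius is positive. *)
Definition ring_dist c w : R := `|w.1.1 - c.1.1.1|
  + `|nrm2 (w.1.2 - c.1.1.2) (w.2 - c.1.2) - c.2|.

Definition point_dist (w w' : point) : R :=
  `|w.1.1 - w'.1.1| + `|w.1.2 - w'.1.2| + `|w.2 - w'.2|.

Definition params_dist c c' : R := point_dist c.1 c'.1 + `|c.2 - c'.2|.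

Lemma point_dist_ge0 w w' : 0 <= point_dist w w'.
Proof. by rewrite !addr_ge0. Qed.

Lemma params_dist_ge0 c c' : 0 <= params_dist c c'.
Proof. by rewrite addr_ge0 ?point_dist_ge0. Qed.

Lemma point_distC w w' : point_dist w w' = point_dist w' w.
Proof.
by rewrite /point_dist distrC (distrC w.1.2) (distrC w.2).
Qed.

Lemma params_distxx c : params_dist c c = 0.
Proof. by rewrite /params_dist /point_dist !subrr normr0 !addr0. Qed.

Lemma params_distC c c' : params_dist c c' = params_dist c' c.
Proof. by rewrite /params_dist point_distC distrC. Qed.

Lemma params_dist_triangle b a c :
  params_dist a c <= params_dist a b + params_dist b c.
Proof.
have := ler_distD b.1.1.1 a.1.1.1 c.1.1.1.
have := ler_distD b.1.1.2 a.1.1.2 c.1.1.2.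
have := ler_distD b.1.2 a.1.2 c.1.2; have := ler_distD b.2 a.2 c.2.
by rewrite /params_dist /point_dist; lra.
Qed.

Lemma params_dist_eq0 c c' : params_dist c c' = 0 -> c = c'.
Proof.
move: c c' => [[[x y] z] r] [[[x' y'] z'] r'] /eqP; rewrite /params_dist /=.
rewrite !paddr_eq0 ?addr_ge0 // !normr_eq0 !subr_eq0 /=.
by move=> /andP[/andP[/andP[/eqP -> /eqP ->] /eqP ->] /eqP ->].
Qed.

Lemma ring_dist_ge0 c w : 0 <= ring_dist c w.
Proof. by rewrite addr_ge0. Qed.

Lemma on_ring_dist c w : 0 < c.2 -> on_ring c w <-> ring_dist c w = 0.
Proof.
move=> r0; rewrite /on_ring /ring_dist -(nrm2_eq _ _ (ltW r0)); split=> [[-> ->]|/eqP].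
  by rewrite !subrr normr0 addr0.
rewrite paddr_eq0 // !normr_eq0 !subr_eq0 => /andP[/eqP -> /eqP ->] //.
Qed.

Lemma ring_dist_gt0 c w : 0 < c.2 -> ~ on_ring c w <-> 0 < ring_dist c w.
Proof.
move=> r0; rewrite on_ring_dist // lt_def ring_dist_ge0 andbT.
by split=> /eqP.
Qed.

(** Joint 1-Lipschitz continuity in the ring and the point; it turns numerical margins into
    statements of avoidance. *)
Lemma ring_dist_lip c c' w w' :
  ring_dist c w <= ring_dist c' w' + point_dist w w' + params_dist c c'.
Proof.
rewrite /ring_dist /params_dist /point_dist.
have h1 := nrm2_lip (w.1.2 - c.1.1.2) (w.2 - c.1.2) (w'.1.2 - c'.1.1.2) (w'.2 - c'.1.2).
have h2 := nrm2_lip (w'.1.2 - c'.1.1.2) (w'.2 - c'.1.2) (w.1.2 - c.1.1.2) (w.2 - c.1.2).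
have d (a b a' b' : R) : `|a - b - (a' - b')| <= `|a - a'| + `|b - b'|.
  by rewrite (_ : _ - _ = (a - a') - (b - b')) ?ler_normB //; lra.
have d' (a b a' b' : R) : `|a - b| <= `|a' - b'| + (`|a - a'| + `|b - b'|).
  apply: le_trans (lerD (lexx _) (d a b a' b')).
  by rewrite -{1}(subrKC (a' - b') (a - b)) ler_normD.
have e1 := d (w.1.2) (c.1.1.2) (w'.1.2) (c'.1.1.2).
have e2 := d (w.2) (c.1.2) (w'.2) (c'.1.2).
have e3 := d' (w.1.1) (c.1.1.1) (w'.1.1) (c'.1.1.1).
have e1' := e1; rewrite distrC in e1'.
have e2' := e2; rewrite distrC in e2'.
have e4 := d' (nrm2 (w.1.2 - c.1.1.2) (w.2 - c.1.2)) c.2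
  (nrm2 (w'.1.2 - c'.1.1.2) (w'.2 - c'.1.2)) c'.2.
set N := nrm2 _ _ in h1 h2 e4 *; set N' := nrm2 _ _ in h1 h2 e4 *.
have : `|N - N'| <= `|w.1.2 - w'.1.2| + `|c.1.1.2 - c'.1.1.2|
    + (`|w.2 - w'.2| + `|c.1.2 - c'.1.2|).
  by rewrite ler_norml; apply/andP; split; lra.
lra.
Qed.

Lemma on_ring_in_disc c w : on_ring c w -> in_disc c w.
Proof. by case=> e e'; split; rewrite ?e'. Qed.

(* The explicit intersection point of two circles in a plane. *)
Lemma nested_or_beside (a b : ring) w : 0 < a.2 -> a.2 < b.2 ->
  (forall v, on_ring a v -> on_ring b v -> False) ->
  in_disc a w -> on_ring b w -> False.
Proof.
case: a => [[[xa ya] za] ra]; case: b => [[[xb yb] zb] rb] /= a0 ab disj.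
case: w => [[x y] z] [] /= -> wa [] /= xab wb; subst xb.
have b0 : 0 < rb by apply: lt_trans ab.
pose A := yb - ya; pose B := zb - za; pose D := A ^+ 2 + B ^+ 2.
have nwa : nrm2 (y - ya) (z - za) <= ra by rewrite (nrm2_le _ _ (ltW a0)).
have nwb : nrm2 (y - yb) (z - zb) = rb by exact: ((nrm2_eq _ _ (ltW b0)).2 wb).
have nNwa : nrm2 (ya - y) (za - z) <= ra.
  by rewrite (nrm2_le _ _ (ltW a0)) -(opprB y) -(opprB z) !sqrrN.
have nNwb : nrm2 (yb - y) (zb - z) = rb.
  by apply: ((nrm2_eq _ _ (ltW b0)).2 _); rewrite -wb -(opprB y) -(opprB z) !sqrrN.
have nAB : nrm2 (-A) (-B) = nrm2 A B by rewrite /nrm2 !sqrrN.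
have lo : rb - ra <= nrm2 A B.
  have := nrm2D (- A) (- B) (y - ya) (z - za).
  have -> : - A + (y - ya) = y - yb by rewrite /A; ring.
  have -> : - B + (z - za) = z - zb by rewrite /B; ring.
  by rewrite nAB nwb lerBlDr => h; apply: le_trans h _; rewrite lerD2l.
have hi : nrm2 A B <= rb + ra.
  have := nrm2D (yb - y) (zb - z) (y - ya) (z - za).
  have -> : yb - y + (y - ya) = A by rewrite /A; ring.
  have -> : zb - z + (z - za) = B by rewrite /B; ring.
  by rewrite nNwb => h; apply: le_trans h _; rewrite lerD2l.
have N0 : 0 < nrm2 A B by apply: lt_le_trans lo; rewrite subr_gt0.
have DE : nrm2 A B ^+ 2 = D by rewrite nrm2_sq.
set N := nrm2 A B in lo hi N0 DE.
(* The fraction of the segment of centres, measured from [a], at which the radical axis crosses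
   it. *)
pose t := (D + ra ^+ 2 - rb ^+ 2) / (2 * D).
have D0 : 0 < D by rewrite -DE exprn_gt0.
have tD : t * D * 2 = D + ra ^+ 2 - rb ^+ 2.
  by rewrite /t; field; rewrite gt_eqF.
(* Multiplied by [4 * D], the numerator is 16 times the squared area of a triangle with sides [ra],
   [rb], [N]. Heron's factorisation makes it nonnegative, [lo] and [hi] being the triangle
   inequalities. *)
have h0 : 0 <= (ra ^+ 2 - t ^+ 2 * D) / D.
  apply: divr_ge0; last exact: ltW.
  have -> : t ^+ 2 * D = (t * D * 2) ^+ 2 / (4 * D) by field; rewrite gt_eqF.
  rewrite subr_ge0 ler_pdivrMr ?mulr_gt0 // tD -DE.
  have p1 : 0 <= (ra + rb) - N by rewrite subr_ge0 addrC.
  have p2 : 0 <= N - (rb - ra) by rewrite subr_ge0.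
  have p3 : 0 <= N + (rb - ra) by rewrite addr_ge0 ?ltW // subr_gt0.
  have p4 : 0 <= (ra + rb) + N by rewrite !addr_ge0 ?ltW.
  rewrite -subr_ge0; apply: le_trans (mulr_ge0 (mulr_ge0 p1 p2) (mulr_ge0 p3 p4)) _.
  by rewrite le_eqVlt; apply/orP; left; apply/eqP; ring.
pose h := Num.sqrt ((ra ^+ 2 - t ^+ 2 * D) / D).
have hh : h ^+ 2 * D = ra ^+ 2 - t ^+ 2 * D.
  by rewrite /h sqr_sqrtr // mulrVK // unitfE gt_eqF.
apply: (disj (xa, ya + t * A - h * B, za + t * B + h * A)); split => //=.
  transitivity (t ^+ 2 * D + h ^+ 2 * D); first by rewrite /D; ring.
  by rewrite hh; ring.
transitivity (D - t * D * 2 + t ^+ 2 * D + h ^+ 2 * D).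
  by rewrite /D /A /B; ring.
by rewrite hh tD; ring.
Qed.

(** The two discs are internally tangent at the point [(x, y + r, z)], hence nested: this is how a
    ring shrinks towards its marked point. *)
Lemma in_disc_shift (x y z r r' : R) w : 0 <= r' -> r' <= r ->
  in_disc (x, y + (r - r'), z, r') w -> in_disc (x, y, z, r) w.
Proof.
move=> r0 rr [/= wx h]; split => //=.
have r0' : 0 <= r by apply: le_trans rr.
rewrite -nrm2_le //; rewrite -nrm2_le // in h.
have := nrm2D (w.1.2 - (y + (r - r'))) (w.2 - z) (r - r') 0.
rewrite addr0 (_ : _ + _ = w.1.2 - y); last by lra.
have -> : nrm2 (r - r') 0 = r - r'.
  by rewrite /nrm2 expr0n addr0 sqrtr_sqr ger0_norm ?subr_ge0.
lra.
Qed.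

Lemma small_disc_dist w (e : R) v : 0 <= e ->
  in_disc (w.1.1, w.1.2 - e, w.2, e) v -> point_dist v w <= 3 * e.
Proof.
move=> e0 [/= vx h]; rewrite -nrm2_le // in h.
have h1 := le_trans (abs_le_nrm2 _ _) h.
rewrite nrm2C in h; have h2 := le_trans (abs_le_nrm2 _ _) h.
rewrite /point_dist vx subrr normr0 add0r.
move: h1 h2; rewrite !ler_norml => /andP[? ?] /andP[? ?].
have : `|v.1.2 - w.1.2| <= 2 * e by rewrite ler_norml; apply/andP; split; lra.
have : `|v.2 - w.2| <= e by rewrite ler_norml; apply/andP; split; lra.
lra.
Qed.

End RingGeometry.

(** * Transport of points avoiding moving rings *)

Section Transport.
Variable R : realType.
Local Notation point := (point R).
Local Notation ring := (ring R).
Implicit Types (w : point) (c : ring).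

Definition disjoint_rings (m : nat) (c : nat -> ring) : Prop :=
  (forall i, (i < m)%N -> 0 < (c i).2) /\
  forall i j, (i < m)%N -> (j < m)%N -> i != j ->
    forall w, on_ring (c i) w -> on_ring (c j) w -> False.

Section Step.
Variables (m : nat) (eta : R).

Definition bump c w : R :=
  Num.max 0 (Num.min 1 (2 - ring_dist c w * eta^-1)).

(* Near the ring c j the step is the similarity taking c j to c' j. *)
Definition ring_step (c c' : nat -> ring) w : point :=
  (w.1.1 + \sum_(j < m) bump (c j) w * ((c' j).1.1.1 - (c j).1.1.1),
   w.1.2 + \sum_(j < m) bump (c j) w * ((c' j).1.1.2 - (c j).1.1.2
     + ((c' j).2 * (c j).2^-1 - 1) * (w.1.2 - (c j).1.1.2)),
   w.2 + \sum_(j < m) bump (c j) w * ((c' j).1.2 - (c j).1.2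
     + ((c' j).2 * (c j).2^-1 - 1) * (w.2 - (c j).1.2))).

Hypothesis eta0 : 0 < eta.

Lemma bump_far c w : 2 * eta <= ring_dist c w -> bump c w = 0.
Proof.
move=> h; have h2 : 2 <= ring_dist c w * eta^-1 by rewrite ler_pdivlMr.
by apply/max_idPl; rewrite ge_min subr_le0 h2 orbT.
Qed.

Lemma bump_near c w : ring_dist c w <= eta -> bump c w = 1.
Proof.
move=> h; have h1 : ring_dist c w * eta^-1 <= 1 by rewrite ler_pdivrMr // mul1r.
by rewrite /bump (min_idPl _) ?(max_idPr _) //; lra.
Qed.

Lemma bump_ge0 c w : 0 <= bump c w. Proof. by rewrite le_max lexx. Qed.

Lemma bump_le1 c w : bump c w <= 1.
Proof. by rewrite ge_max ler01 ge_min lexx. Qed.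

Lemma ring_step_far (c c' : nat -> ring) w :
  (forall j, (j < m)%N -> 2 * eta <= ring_dist (c j) w) ->
  ring_step c c' w = w.
Proof.
move=> far; rewrite /ring_step !big1 ?addr0; first by case: w {far} => [[]].
all: by move=> j _; rewrite bump_far ?mul0r // far.
Qed.

Lemma ring_step_fix (c : nat -> ring) w :
  (forall j, (j < m)%N -> 0 < (c j).2) -> ring_step c c w = w.
Proof.
move=> r0; rewrite /ring_step !big1 ?addr0; first by case: w => [[]].
all: move=> j _; rewrite subrr ?mulr0 //.
all: by rewrite divff ?subrr ?mul0r ?addr0 ?mulr0 // gt_eqF // r0.
Qed.

Variable kappa : R.
Hypothesis small : 8 * kappa < eta.
Variables c c' : nat -> ring.
Hypothesis radius_lb : forall j, (j < m)%N -> 2 * eta <= (c j).2.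
Hypothesis radius'_gt0 : forall j, (j < m)%N -> 0 < (c' j).2.
Hypothesis separated : forall i j, (i < m)%N -> (j < m)%N -> i != j ->
  forall w, 4 * eta <= ring_dist (c i) w + ring_dist (c j) w.
Hypothesis close : forall j, (j < m)%N -> params_dist (c j) (c' j) <= kappa.

(** By [separated], the [2 * eta]-neighbourhoods of the rings are disjoint, so at most one summand
    acts on [w]. Within [eta] of ring [k] the step is a similarity taking [c k] to [c' k], which
    preserves being off the ring. A ring at distance at least [eta] from [w] cannot be reached, as
    point and ring move too little. *)
Lemma ring_step_avoid w :
  (forall j, (j < m)%N -> ~ on_ring (c j) w) ->
  forall j, (j < m)%N -> ~ on_ring (c' j) (ring_step c c' w).
Proof.
move=> off l lm; have [sm e0] := (small, eta0).
have r0 j : (j < m)%N -> 0 < (c j).2.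
  by move=> jm; apply: lt_le_trans (radius_lb jm); rewrite mulr_gt0.
have k0 : 0 <= kappa by apply: le_trans (close lm); exact: params_dist_ge0.
(* The coordinates of the point move by at most [kappa], [3 * kappa] and [3 * kappa]; one more
   [kappa] for the ring gives the 8 of [small]. *)
have moved v j : (j < m)%N -> eta <= ring_dist (c j) w ->
    point_dist w v <= 7 * kappa -> ~ on_ring (c' j) v.
  move=> jm dj vw; apply/ring_dist_gt0; first exact: radius'_gt0.
  have := ring_dist_lip (c j) (c' j) w v; have := close jm; lra.
have [[k km dk]|near0] := pselect (exists2 k, (k < m)%N &
    ring_dist (c k) w < 2 * eta); last first.
  have far j : (j < m)%N -> 2 * eta <= ring_dist (c j) w.
    by move=> jm; rewrite leNgt; apply/negP => h; apply: near0; exists j.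
  rewrite ring_step_far //; apply: moved => //.
    by have := far l lm; lra.
  rewrite /point_dist !subrr normr0 !addr0; lra.
have far j : (j < m)%N -> j != k -> 2 * eta <= ring_dist (c j) w.
  by move=> jm jk; have := separated jm km jk w; lra.
pose x := w.1.1 + bump (c k) w * ((c' k).1.1.1 - (c k).1.1.1).
pose y := w.1.2 + bump (c k) w * ((c' k).1.1.2 - (c k).1.1.2
     + ((c' k).2 * (c k).2^-1 - 1) * (w.1.2 - (c k).1.1.2)).
pose z := w.2 + bump (c k) w * ((c' k).1.2 - (c k).1.2
     + ((c' k).2 * (c k).2^-1 - 1) * (w.2 - (c k).1.2)).
have -> : ring_step c c' w = (x, y, z).
  have sumE (F : 'I_m -> R) :
      \sum_(j < m) bump (c j) w * F j = bump (c k) w * F (Ordinal km).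
    rewrite (bigD1 (Ordinal km)) //= big1 ?addr0 // => j jk.
    by rewrite bump_far ?mul0r // far.
  by rewrite /ring_step !sumE.
have := close km; rewrite /params_dist /point_dist => ck.
have [[[n1 n2] n3] n4] := (normr_ge0 ((c k).1.1.1 - (c' k).1.1.1),
  normr_ge0 ((c k).1.1.2 - (c' k).1.1.2), normr_ge0 ((c k).1.2 - (c' k).1.2),
  normr_ge0 ((c k).2 - (c' k).2)).
have [b0 b1] := (bump_ge0 (c k) w, bump_le1 (c k) w).
(* Within [2 * eta] of the ring, the distance to its axis is below the radius plus [2 * eta], hence
   at most twice the radius, so rescaling displaces by at most twice the change of radius. *)
have scaled d : `|d| <= nrm2 (w.1.2 - (c k).1.1.2) (w.2 - (c k).1.2) ->
    `|((c' k).2 * (c k).2^-1 - 1) * d| <= 2 * `|(c k).2 - (c' k).2|.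
  move=> dn; rewrite normrM.
  have -> : (c' k).2 * (c k).2^-1 - 1 = - ((c k).2 - (c' k).2) / (c k).2.
    by field; rewrite gt_eqF // r0.
  rewrite normrM normrN normfV (gtr0_norm (r0 k km)) mulrAC -mulrA (mulrC 2).
  apply: ler_wpM2l => //; rewrite ler_pdivrMr ?r0 //.
  apply: le_trans dn _.
  have : `|nrm2 (w.1.2 - (c k).1.1.2) (w.2 - (c k).1.2) - (c k).2| < 2 * eta.
    by apply: le_lt_trans dk; rewrite lerDr.
  by rewrite ltr_norml => /andP[_]; have := radius_lb km; lra.
have dmove a e : `|e| <= a -> `|w.1.1 - w.1.1 + bump (c k) w * e| <= a.
  move=> ea; rewrite subrr add0r normrM (ger0_norm b0).
  by apply: le_trans ea; rewrite ler_piMl.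
have dx : `|w.1.1 - x| <= kappa.
  rewrite -normrN /x opprB addrAC; apply: dmove; rewrite distrC; lra.
have dy : `|w.1.2 - y| <= 3 * kappa.
  rewrite (_ : w.1.2 - y = - (w.1.1 - w.1.1 + (y - w.1.2))) ?normrN; last ring.
  rewrite /y [w.1.2 + _]addrC addrK; apply: dmove.
  apply: le_trans (ler_normD _ _) _; rewrite distrC.
  by have := scaled _ (abs_le_nrm2 _ _); lra.
have dz : `|w.2 - z| <= 3 * kappa.
  rewrite (_ : w.2 - z = - (w.1.1 - w.1.1 + (z - w.2))) ?normrN; last ring.
  rewrite /z [w.2 + _]addrC addrK; apply: dmove.
  apply: le_trans (ler_normD _ _) _; rewrite distrC.
  have : `|w.2 - (c k).1.2| <= nrm2 (w.1.2 - (c k).1.1.2) (w.2 - (c k).1.2).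
    by rewrite nrm2C abs_le_nrm2.
  by move=> /scaled; lra.
have dv : point_dist w (x, y, z) <= 7 * kappa by rewrite /point_dist /=; lra.
have [lk|lk] := eqVneq l k; last first.
  by apply: moved dv => //; have := far l lm lk; lra.
rewrite {}lk {l lm}; have [nk|fk] := leP (ring_dist (c k) w) eta; last first.
  by apply: moved dv => //; exact: ltW.
(* Here the bump is 1, so the similarity can be undone: an image on [c' k] would come from a point
   of [c k]. *)
clear dx dy dz dv dmove; move: @x @y @z; rewrite bump_near // !mul1r => x y z [/= ex e].
apply: (off k km); split; first by move: ex; rewrite /x; lra.
have rk := r0 k km; have rk' := radius'_gt0 km.
have rr : 0 < (c' k).2 / (c k).2 by rewrite divr_gt0.
move: e; rewrite (_ : y - _ = (c' k).2 / (c k).2 * (w.1.2 - (c k).1.1.2));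
  last by rewrite /y; ring.
rewrite (_ : z - _ = (c' k).2 / (c k).2 * (w.2 - (c k).1.2));
  last by rewrite /z; ring.
rewrite !exprMn -mulrDr => e; apply: (mulfI (x := ((c' k).2 ^+ 2 * ((c k).2)^-1 ^+ 2))).
  by rewrite mulf_neq0 // expf_neq0 // ?invr_eq0 gt_eqF.
by rewrite e -mulrA -exprMn mulVf ?expr1n ?mulr1 // gt_eqF.
Qed.

End Step.

Lemma cts_ring_dist (Z : topologicalType) (c : Z -> ring) (w : Z -> point) :
  continuous c -> continuous w -> continuous (fun z => ring_dist (c z) (w z)).
Proof. by move=> cc cw; rewrite /ring_dist /nrm2; cts. Qed.

Lemma cts_ring_step (Z : topologicalType) m eta (c c' : nat -> Z -> ring)
    (w : Z -> point) :
  (forall j, (j < m)%N -> continuous (c j)) ->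
  (forall j, (j < m)%N -> continuous (c' j)) ->
  (forall j z, (j < m)%N -> 0 < (c j z).2) ->
  continuous w ->
  continuous (fun z => ring_step m eta (c^~ z) (c'^~ z) (w z)).
Proof.
move=> cc cc' r0 cw; rewrite /ring_step /bump.
have cF (j : 'I_m) : [/\ continuous (c j), continuous (c' j),
    continuous (fun z => ring_dist (c j z) (w z)) &
    continuous (fun z => (c j z).2^-1)].
  have [ccj ccj'] := (cc j (ltn_ord j), cc' j (ltn_ord j)).
  split=> //; first exact: cts_ring_dist.
  by apply: cts_inv; [cts|move=> z; rewrite gt_eqF // r0].
apply: continuous_pair; first apply: continuous_pair.
all: apply: cts_add; first cts.
all: by apply: cts_sum => j; case: (cF j) => ? ? ? ?; cts.
Qed.

End Transport.

(** * Transport along a family of paths of configurations *)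

Section TransportAlongPaths.
Variable R : realType.
Local Notation point := (point R).
Local Notation ring := (ring R).
Variables (m : nat) (C : nat -> R * R -> ring).
Hypothesis ctsC : forall j, (j < m)%N -> continuous (C j).
Hypothesis disjC : forall z, disjoint_rings m (C^~ z).

(** The first coordinate numbers the paths, the second is the time along them; times 0 and 2 will be
    the poles of the sphere. *)
Definition strip : set (R * R) := `[0, 1]%classic `*` `[0, 2]%classic.

Lemma strip_compact : compact strip.
Proof. by apply: compact_setX; exact: segment_compact. Qed.

Lemma stripP (s u : R) : 0 <= s <= 1 -> 0 <= u <= 2 -> strip (s, u).
Proof. by move=> s01 u02; split; rewrite /= in_itv. Qed.

Lemma rings_bounded : exists2 M : R, 0 < M &
  forall j z, (j < m)%N -> strip z -> params_dist (C j z) (0, 0, 0, 0) <= M.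
Proof.
(* The bound is written [t^-1] so that an upper bound becomes a property of all small [t], as
   [min_threshold] expects. *)
suff [e e0 h] : exists2 e : R, 0 < e & forall j t, (j < m)%N -> 0 < t ->
    t <= e -> forall z, strip z -> params_dist (C j z) (0, 0, 0, 0) <= t^-1.
  exists e^-1; first by rewrite invr_gt0.
  by move=> j z jm; exact: h.
apply: (@min_threshold R m (fun j t => forall z, strip z ->
  params_dist (C j z) (0, 0, 0, 0) <= t^-1)) => j jm.
have cp : continuous (fun z => params_dist (C j z) (0, 0, 0, 0)).
  by have := ctsC jm; rewrite /params_dist /point_dist => ?; cts.
have cf : continuous (fun z => (1 + params_dist (C j z) (0, 0, 0, 0))^-1).
  apply: cts_inv; first by cts.
  by move=> z; rewrite gt_eqF // ltr_pwDl // params_dist_ge0.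
have [z _|e e0 he] := compact_pos_lbound strip_compact cf.
  by rewrite invr_gt0 ltr_pwDl // params_dist_ge0.
exists e => // t t0 te z sz.
have := he z sz; rewrite -[leRHS]mul1r ler_pdivlMr ?ltr_pwDl ?params_dist_ge0 //.
rewrite -ler_pdivlMl // mulr1 => h.
have : e^-1 <= t^-1 by rewrite lef_pV2.
lra.
Qed.

(** Some coordinate of [w] exceeds [M + 1] in absolute value, whereas each coordinate of the centre
    plus the radius stays below [M]. *)
Lemma ring_dist_unbounded c (w : point) (M : R) :
  params_dist c (0, 0, 0, 0) <= M -> point_dist w (0, 0, 0) > 3 * M + 3 ->
  1 <= ring_dist c w.
Proof.
rewrite /params_dist /point_dist /ring_dist /= !subr0 => cM wM.
have h1 := abs_le_nrm2 (w.1.2 - c.1.1.2) (w.2 - c.1.2).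
have h2 := abs_le_nrm2 (w.2 - c.1.2) (w.1.2 - c.1.1.2); rewrite nrm2C in h2.
have k1 := lerB_dist w.1.1 c.1.1.1; have k2 := lerB_dist w.1.2 c.1.1.2.
have k3 := lerB_dist w.2 c.1.2.
have k4 := lerB_dist (nrm2 (w.1.2 - c.1.1.2) (w.2 - c.1.2)) c.2.
rewrite (ger0_norm (nrm2_ge0 _ _)) in k4.
have := normr_ge0 c.1.1.1; have := normr_ge0 c.1.1.2; have := normr_ge0 c.1.2.
have := normr_ge0 c.2; have := normr_ge0 (w.1.1 - c.1.1.1).
have := normr_ge0 (nrm2 (w.1.2 - c.1.1.2) (w.2 - c.1.2) - c.2).
lra.
Qed.

(** The sum of the distances to two disjoint rings never vanishes, so it is bounded below over the
    compact [strip] times [box]; outside the box it is at least 1, whence the threshold [4^-1] in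
    the proof. *)
Lemma rings_margin : exists2 eta : R, 0 < eta & forall z, strip z ->
  (forall j, (j < m)%N -> 2 * eta <= (C j z).2) /\
  forall i j, (i < m)%N -> (j < m)%N -> i != j ->
    forall w, 4 * eta <= ring_dist (C i z) w + ring_dist (C j z) w.
Proof.
have [M M0 hM] := rings_bounded.
pose L := 3 * M + 3.
pose box : set point := `[-L, L]%classic `*` `[-L, L]%classic `*` `[-L, L]%classic.
have cbox : compact box by do !apply: compact_setX; exact: segment_compact.
have boxP w : ~ box w -> point_dist w (0, 0, 0) > L.
  move=> nb; rewrite ltNge; apply/negP; rewrite /point_dist !subr0 => h; apply: nb.
  have := normr_ge0 w.1.1; have := normr_ge0 w.1.2; have := normr_ge0 w.2.
  by move=> *; (do !split) => /=; rewrite in_itv /= -ler_norml; lra.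
have [e1 e10 h1] : exists2 e : R, 0 < e & forall j t, (j < m)%N -> 0 < t ->
    t <= e -> forall z, strip z -> 2 * t <= (C j z).2.
  apply: (@min_threshold R m (fun j t => forall z, strip z -> 2 * t <= (C j z).2)).
  move=> j jm; have cr : continuous (fun z => (C j z).2).
    by have := ctsC jm => ?; cts.
  have [z _|e e0 he] := compact_pos_lbound strip_compact cr.
    exact: (disjC z).1.
  exists (e / 2); first by rewrite divr_gt0.
  by move=> t t0 te z sz; have := he z sz; lra.
have [e2 e20 h2] : exists2 e : R, 0 < e & forall i t, (i < m)%N -> 0 < t ->
    t <= e -> forall j t, (j < m)%N -> 0 < t -> t <= e -> i != j ->
    forall z w, strip z -> 4 * t <= ring_dist (C i z) w + ring_dist (C j z) w.
  pose P i j t := i != j -> forall z w, strip z ->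
    4 * t <= ring_dist (C i z) w + ring_dist (C j z) w.
  suff [e e0 h] : exists2 e : R, 0 < e & forall i t, (i < m)%N -> 0 < t ->
      t <= e -> forall j, (j < m)%N -> P i j t.
    by exists e => // i _ im _ _ j t jm t0 te; exact: h.
  apply: (@min_threshold R m (fun i t => forall j, (j < m)%N -> P i j t)) => i im.
  suff [e e0 h] : exists2 e : R, 0 < e & forall j t, (j < m)%N -> 0 < t ->
      t <= e -> P i j t.
    by exists e => // t t0 te j jm; exact: h.
  apply: (@min_threshold R m (P i)) => j jm.
  have cd : continuous (fun zw : (R * R) * point =>
      ring_dist (C i zw.1) zw.2 + ring_dist (C j zw.1) zw.2).
    have cC k : (k < m)%N -> continuous (fun zw : (R * R) * point => C k zw.1).
      by move=> km; apply: (continuous_compose (g := C k)); [cts|exact: ctsC].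
    by apply: cts_add; apply: cts_ring_dist; try cts; exact: cC.
  have [->|ij] := eqVneq i j; first by exists 1 => // t _ _; rewrite /P eqxx.
  have [zw _|e e0 he] := compact_pos_lbound (compact_setX strip_compact cbox) cd.
    have [ri rj] := ((disjC zw.1).1 i im, (disjC zw.1).1 j jm).
    rewrite lt_def addr_ge0 ?ring_dist_ge0 // andbT paddr_eq0 ?ring_dist_ge0 //.
    apply/negP => /andP[/eqP /(on_ring_dist _ ri) oi /eqP /(on_ring_dist _ rj)].
    exact: (disjC zw.1).2 oi.
  exists (Num.min (e / 4) 4^-1); first by rewrite lt_min divr_gt0 //=; lra.
  move=> t t0; rewrite le_min => /andP[te t1] _ z w sz.
  have [bw|/boxP fw] := pselect (box w).
    by have := he (z, w) (conj sz bw); rewrite /=; lra.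
  have := ring_dist_unbounded (hM i z im sz) fw.
  by have := ring_dist_ge0 (C j z) w; lra.
exists (Num.min e1 e2); first by rewrite lt_min e10.
have [t0 t1 t2] : [/\ 0 < Num.min e1 e2, Num.min e1 e2 <= e1 & Num.min e1 e2 <= e2].
  by rewrite lt_min e10 e20 !ge_min !lexx orbT.
move=> z sz; split; first by move=> j jm; exact: (h1 j).
by move=> i j im jm ij w; exact: (h2 i _ im t0 t2).
Qed.

Lemma rings_uniformly_continuous (kappa : R) : 0 < kappa ->
  exists2 d : R, 0 < d & forall j s u u', (j < m)%N -> 0 <= s <= 1 ->
    0 <= u <= 2 -> `|u - u'| < d -> params_dist (C j (s, u)) (C j (s, u')) <= kappa.
Proof.
move=> k0.
suff [d d0 h] : exists2 d : R, 0 < d & forall j t, (j < m)%N -> 0 < t -> t <= d ->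
    forall y z, strip y -> ball y t z -> params_dist (C j y) (C j z) <= kappa.
  exists d => // j s u u' jm s01 u02 uu.
  apply: (h j d jm d0 (lexx d) (s, u) (s, u')); first exact: stripP.
  by split => //=; exact: ballxx.
apply: (@min_threshold R m (fun j t => forall y z, strip y -> ball y t z ->
  params_dist (C j y) (C j z) <= kappa)) => j jm.
have [x sx|d d0 h] := @lebesgue_number R _ strip
    (fun y z => params_dist (C j y) (C j z) <= kappa) strip_compact.
  have : \forall z \near x, params_dist (C j x) (C j z) < kappa / 2.
    have cf : continuous (fun z => params_dist (C j x) (C j z)).
      by have := ctsC jm; rewrite /params_dist /point_dist => ?; cts.
    move: (cf x) => /cvgr_lt; apply.
    by rewrite /params_dist /point_dist !subrr normr0 !addr0 divr_gt0.
  move=> /nbhs_ballP [d /= d0 hd]; exists d => // y z xy xz.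
  have := params_dist_triangle (C j x) (C j y) (C j z).
  by have := hd _ xy; have := hd _ xz; rewrite /= (params_distC (C j y) (C j x)); lra.
exists d => // t t0 td y z sy yz; apply: h => //; exact: le_ball yz.
Qed.

(* The times [2k/N] clamped to [u, u'], so that one formula transports between
   all pairs of times. *)
Definition time (N : nat) (u u' : R) (k : nat) : R :=
  Num.max u (Num.min u' (2 * k%:R * N%:R^-1)).

Fixpoint transport (eta : R) (N : nat) (s u u' : R) (w : point) (k : nat) : point :=
  if k is k'.+1 then
    ring_step m eta (fun j => C j (s, time N u u' k'))
      (fun j => C j (s, time N u u' k)) (transport eta N s u u' w k')
  else w.

Lemma transport_cts eta N k (Z : topologicalType) (S U U' : Z -> R) (W : Z -> point) :
  continuous S -> continuous U -> continuous U' -> continuous W ->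
  continuous (fun z => transport eta N (S z) (U z) (U' z) (W z) k).
Proof.
move=> cS cU cU' cW; elim: k => [|k IH] //=.
have cC l j : (j < m)%N -> continuous (fun z => C j (S z, time N (U z) (U' z) l)).
  move=> jm; apply: (continuous_compose (g := C j)); last exact: ctsC.
  by rewrite /time; cts.
apply: (@cts_ring_step R Z m eta (fun j z => C j (S z, time N (U z) (U' z) k))
  (fun j z => C j (S z, time N (U z) (U' z) k.+1))) => //.
- by move=> j jm; exact: cC.
- by move=> j jm; exact: cC.
- by move=> j z jm; exact: (disjC _).1.
Qed.

Lemma transport_eq eta N k s s' u u' w :
  (forall j v, (j < m)%N -> C j (s, v) = C j (s', v)) ->
  transport eta N s u u' w k = transport eta N s' u u' w k.
Proof.
move=> e; elim: k => //= k ->; rewrite /ring_step /=.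
by congr (_ + _, _ + _, _ + _); apply: eq_bigr => j _; rewrite !e.
Qed.

Lemma transport_id eta N k s u w : transport eta N s u u w k = w.
Proof.
elim: k => //= k ->; rewrite /time.
have t l : Num.max u (Num.min u (2 * l%:R / N%:R)) = u.
  by apply/max_idPl; rewrite ge_min lexx.
by rewrite !t ring_step_fix // => j jm; exact: (disjC _).1.
Qed.

(** Compactness gives a margin [eta] between the rings and a number [N] of steps so large that each
    moves the rings by little compared with [eta]. The last clause yields [T 0 = T 1] once the
    family of paths closes up. *)
Lemma transport_exists : exists T : R -> R -> R -> point -> point,
  [/\ forall (Z : topologicalType) (S U U' : Z -> R) (W : Z -> point),
        continuous S -> continuous U -> continuous U' -> continuous W ->
        continuous (fun z => T (S z) (U z) (U' z) (W z)),
      forall s u u' w, 0 <= s <= 1 -> 0 <= u -> u <= u' -> u' <= 2 ->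
        (forall j, (j < m)%N -> ~ on_ring (C j (s, u)) w) ->
        forall j, (j < m)%N -> ~ on_ring (C j (s, u')) (T s u u' w),
      forall s u w, T s u u w = w,
      exists M : R, forall s u u' w, 0 <= s <= 1 -> 0 <= u -> u <= u' -> u' <= 2 ->
        M <= `|w.1.2| -> T s u u' w = w &
      forall s s', (forall j v, (j < m)%N -> C j (s, v) = C j (s', v)) ->
        T s = T s'].
Proof.
have [eta eta0 marg] := rings_margin.
(* Any [kappa] with [8 * kappa < eta] suits [ring_step_avoid]. *)
have k0 : 0 < eta / 9 by rewrite divr_gt0.
have [d d0 unif] := rings_uniformly_continuous k0.
have [M M0 hM] := rings_bounded.
pose N := (Num.truncn (2 / d)).+1.
have N0 : 0 < N%:R :> R by rewrite ltr0n.
have Nd : 2 / N%:R < d.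
  have : 2 / d < N%:R by exact: truncnS_gt.
  by rewrite !ltr_pdivrMr // mulrC.
exists (fun s u u' w => transport eta N s u u' w N).
have time02 u u' k : 0 <= u -> u <= u' -> u' <= 2 -> 0 <= time N u u' k <= 2.
  move=> u0 uu u2; rewrite /time le_max u0 ge_max (le_trans uu u2).
  by rewrite ge_min u2.
split.
- by move=> Z S U U' W *; exact: transport_cts.
- move=> s u u' w s01 u0 uu u2 off.
  have tN : time N u u' N = u'.
    rewrite /time mulfK ?gt_eqF // (min_idPl _) //; exact/max_idPr.
  suff h k j : (j < m)%N ->
      ~ on_ring (C j (s, time N u u' k)) (transport eta N s u u' w k).
    by move=> j jm; rewrite -{1}tN; exact: h.
  elim: k j => [|k IH] j jm /=.
    have -> : time N u u' 0 = u.
      by apply/max_idPl; rewrite mulr0 mul0r ge_min u0 orbT.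
    exact: off.
  have sk := stripP s01 (time02 u u' k u0 uu u2).
  have [m1 m2] := marg _ sk.
  apply: (@ring_step_avoid _ m eta eta0 (eta / 9) _ (fun j => C j (s, time N u u' k))
    (fun j => C j (s, time N u u' k.+1))) => //.
  + lra.
  + by move=> i im; exact: (disjC _).1.
  + move=> i im; apply: unif => //; first exact: time02.
    apply: le_lt_trans Nd; rewrite /time.
    set a := 2 * k%:R / N%:R; set b := 2 * k.+1%:R / N%:R.
    have -> : b = a + 2 / N%:R.
      by rewrite /a /b -[k.+1%:R]natr1 mulrDr mulr1 mulrDl.
    have e0 : 0 < 2 / N%:R :> R by rewrite divr_gt0.
    move: (2 / N%:R) e0 => e e0; rewrite ler_norml.
    by rewrite /Num.max /Num.min; do !case: ifP => //; move=> *; lra.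
- by move=> s u w; exact: transport_id.
- exists (3 * M + 4 + 2 * eta + M) => s u u' w s01 u0 uu u2 fw.
  suff h k : transport eta N s u u' w k = w by exact: h.
  elim: k => //= k ->; apply: ring_step_far => // j jm.
  have := hM j _ jm (stripP s01 (time02 u u' k u0 uu u2)).
  move: (C j _) => c; rewrite /params_dist /point_dist /ring_dist /= !subr0 => cM.
  have h1 := abs_le_nrm2 (w.1.2 - c.1.1.2) (w.2 - c.1.2).
  have k1 := lerB_dist w.1.2 c.1.1.2.
  have k4 := lerB_dist (nrm2 (w.1.2 - c.1.1.2) (w.2 - c.1.2)) c.2.
  rewrite (ger0_norm (nrm2_ge0 _ _)) in k4.
  have := normr_ge0 c.1.1.1; have := normr_ge0 c.1.1.2; have := normr_ge0 c.1.2.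
  have := normr_ge0 c.2; have := normr_ge0 (w.1.1 - c.1.1.1).
  lra.
- move=> s s' e; apply/funext => u; apply/funext => u'; apply/funext => w.
  exact: transport_eq.
Qed.

End TransportAlongPaths.

(** * The induction on the number of rings *)

Section Filling.
Variable R : realType.
Local Notation point := (point R).
Local Notation ring := (ring R).

(** Labels increase with the radius, so ring 0 is the smallest and forgetting it is the shift
    [j.+1]. The condition on discs is a consequence of disjointness ([disjoint_increasing_good]),
    kept here because it allows shrinking and implies unlinkedness. *)
Definition good_rings (n : nat) (c : nat -> ring) : Prop :=
  (forall i, (i < n)%N -> 0 < (c i).2) /\
  forall i j, (i < j)%N -> (j < n)%N -> (c i).2 < (c j).2 /\
    forall w, in_disc (c i) w -> on_ring (c j) w -> False.

Lemma good_disjoint n (c : nat -> ring) : good_rings n c -> disjoint_rings n c.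
Proof.
move=> [r0 g]; split=> // i j i_n j_n; rewrite neq_ltn => /orP[ij|ji] w oi oj.
  exact: ((g i j ij j_n).2 w (on_ring_in_disc oi)).
exact: ((g j i ji i_n).2 w (on_ring_in_disc oj)).
Qed.

Lemma disjoint_increasing_good n (c : nat -> ring) : disjoint_rings n c ->
  (forall i j, (i < j)%N -> (j < n)%N -> (c i).2 < (c j).2) -> good_rings n c.
Proof.
move=> [r0 d] incr; split=> // i j ij jn; split; first exact: incr.
have i_n := ltn_trans ij jn.
move=> w; apply: nested_or_beside; [exact: r0|exact: incr|].
by move=> v; apply: d => //; rewrite ltn_eqF.
Qed.

Definition clamp (a : R) : R := Num.max 0 (Num.min 1 a).

Lemma clamp01 a : 0 <= clamp a <= 1.
Proof. by rewrite /clamp le_max lexx /= ge_max ler01 ge_min lexx. Qed.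

Lemma clampE a : 0 <= a <= 1 -> clamp a = a.
Proof. by move=> /andP[a0 a1]; rewrite /clamp (min_idPr a1) (max_idPr a0). Qed.

Lemma clamp_le0 a : a <= 0 -> clamp a = 0.
Proof. by move=> a0; apply/max_idPl; rewrite ge_min a0 orbT. Qed.

Lemma clamp_ge1 a : 1 <= a -> clamp a = 1.
Proof. by move=> a1; rewrite /clamp (min_idPl a1) (max_idPr ler01). Qed.

(** A small shift in the x direction leaves the planes of all the rings at once; the point then
    travels as far as wanted in a plane parallel to them. *)
Lemma escape_path m (c : nat -> ring) (w : point) (M : R) :
  (forall j, (j < m)%N -> ~ on_ring (c j) w) ->
  exists sigma : R -> point, [/\ continuous sigma, sigma 0 = w,
    forall v, 0 <= v <= 1 -> forall j, (j < m)%N -> ~ on_ring (c j) (sigma v) &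
    M <= `|(sigma 1).1.2|].
Proof.
move=> off.
have [|e e0 he] := @min_threshold R m (fun j t => w.1.1 + t != (c j).1.1.1).
  move=> j _; have [wj|jw] := ltP w.1.1 (c j).1.1.1.
    exists (((c j).1.1.1 - w.1.1) / 2); first by rewrite divr_gt0 // subr_gt0.
    by move=> t t0 tj; rewrite lt_eqF //; lra.
  by exists 1 => // t t0 _; rewrite gt_eqF //; lra.
pose B := `|w.1.2| + `|M|.
exists (fun v => (w.1.1 + e * Num.min 1 (2 * v),
  w.1.2 + B * Num.max 0 (2 * v - 1), w.2)); split => /=.
- by cts.
- rewrite mulr0 (min_idPr ler01) mulr0 addr0 sub0r (max_idPl _) ?mulr0 ?addr0; last lra.
  by case: w {off he B} => [[]].
- move=> v /andP[v0 v1] j jm; have [v0'|v0'] := ltP 0 v; last first.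
    have -> : v = 0 by lra.
    rewrite mulr0 (min_idPr ler01) mulr0 addr0 sub0r (max_idPl _) ?mulr0 ?addr0; last lra.
    have := off j jm; by case: w {off he B} => [[]].
  move=> [/= /eqP wj _]; apply/negP: wj; apply: he => //.
    by rewrite mulr_gt0 // lt_min ltr01 mulr_gt0.
  by rewrite -[leRHS]mulr1 (ler_wpM2l (ltW e0)) // ge_min lexx.
- have -> : 2 * 1 - 1 = 1 :> R by lra.
  rewrite (max_idPr ler01) mulr1; apply: le_trans (ler_norm _); rewrite /B.
  have := ler_norm M; have := ler_norm (- w.1.2); rewrite normrN; lra.
Qed.

(* [K] contracts the loop [H j (_, 0)]; its base point may move. *)
Definition free_filling n (H K : nat -> R * R -> ring) :=
  [/\ forall j, (j < n)%N -> continuous (K j),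
      forall z, good_rings n (K^~ z),
      forall j s, (j < n)%N -> 0 <= s <= 1 -> K j (s, 0) = H j (s, 0),
      forall j v, (j < n)%N -> K j (0, v) = K j (1, v) &
      forall j s, (j < n)%N -> K j (s, 1) = K j (0, 1)].

Section InductionStep.
Variables (n : nat) (H G : nat -> R * R -> ring).
Hypothesis ctsH : forall j, (j < n.+1)%N -> continuous (H j).
Hypothesis disjH : forall z, disjoint_rings n.+1 (H^~ z).
Hypothesis goodH : forall s, good_rings n.+1 (H^~ (s, 0)).
Hypothesis loopH : forall j v, (j < n.+1)%N -> H j (0, v) = H j (1, v).
Hypothesis topH : forall j s, (j < n.+1)%N -> H j (s, 1) = H j (0, 1).
Hypothesis fillG : free_filling n (fun j => H j.+1) G.

(* A sphere of configurations with meridians [C j (s, _)]: on [0, 1] the rings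
   of [H] other than the smallest, backwards, then the filling [G] on [1, 2]. *)
Let C (j : nat) (z : R * R) : ring :=
  if z.2 <= 1 then H j.+1 (clamp z.1, 1 - z.2) else G j (clamp z.1, z.2 - 1).

Let ctsC j : (j < n)%N -> continuous (C j).
Proof.
have [cG _ eqG _ _] := fillG; move=> jn.
apply: (@continuous_if R _ _ snd 1 (fun z => H j.+1 (clamp z.1, 1 - z.2))
  (fun z => G j (clamp z.1, z.2 - 1))).
- by cts.
- by apply: (continuous_compose (g := H j.+1)); [rewrite /clamp; cts|exact: ctsH].
- by apply: (continuous_compose (g := G j)); [rewrite /clamp; cts|exact: cG].
- by move=> z ->; rewrite subrr eqG //; exact: clamp01.
Qed.

Let goodC s u : 1 <= u -> good_rings n (C^~ (s, u)).
Proof.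
have [_ gG _ _ _] := fillG; move=> u1; rewrite /C /=; have [u1'|_] := leP u 1; last exact: gG.
have -> : u = 1 by apply/eqP; rewrite eq_le u1 u1'.
rewrite subrr; have [r0 g] := goodH (clamp s).
by split=> [i i_n|i j ij jn]; [exact: r0|exact: (g i.+1 j.+1)].
Qed.

Let disjC z : disjoint_rings n (C^~ z).
Proof.
case: z => s u; have [u1|u1] := leP u 1; last exact/good_disjoint/goodC/ltW.
rewrite /C /= u1; have [r0 d] := disjH (clamp s, 1 - u).
by split=> [i i_n|i j i_n jn ij]; [exact: r0|exact: (d i.+1 j.+1)].
Qed.

Let loopC j v : (j < n)%N -> C j (0, v) = C j (1, v).
Proof.
have [_ _ _ lG _] := fillG; move=> jn.
by rewrite /C /= clamp_le0 // clamp_ge1 // lG // loopH.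
Qed.

Let southC j s : (j < n)%N -> C j (s, 0) = H j.+1 (0, 1).
Proof. by move=> jn; rewrite /C /= ler01 subr0 topH. Qed.

Let northC j s : (j < n)%N -> C j (s, 2) = G j (0, 1).
Proof.
have [_ _ _ _ tG] := fillG; move=> jn.
have e1 : (2 <= 1 :> R) = false by apply/negbTE; rewrite -ltNge ltr1n.
have e2 : 2 - 1 = 1 :> R by rewrite -[2]/(1 + 1) addrK.
by rewrite /C /= e1 e2 tG.
Qed.

(* The marked point of the smallest ring. *)
Let q (z : R * R) : point :=
  let c := H 0 (z.1, 1 - z.2) in (c.1.1.1, c.1.1.2 + c.2, c.1.2).

Let ctsq : continuous q.
Proof.
rewrite /q /=; have cH : continuous (fun z : R * R => H 0 (z.1, 1 - z.2)).
  by apply: (continuous_compose (g := H 0)); [cts|exact: ctsH].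
cts.
Qed.

Let offq s u : 0 <= s <= 1 -> u <= 1 ->
  forall j, (j < n)%N -> ~ on_ring (C j (s, u)) (q (s, u)).
Proof.
move=> s01 u1 j jn; rewrite /C /= u1 clampE //.
apply: ((disjH (s, 1 - u)).2 0%N j.+1) => //; rewrite /q; split => //=.
by rewrite subrr expr0n addr0 addrC addKr.
Qed.

Let southq s : q (s, 0) = q (0, 0).
Proof. by rewrite /q /= !subr0 topH. Qed.

(** The marked point is picked at latitude [u1 w] and transported to latitude [u2 w]. The pair is
    (1, 1) for [w <= 0], then (1, 1 + w), then (2 - w, 2), and (0, 2) from [w = 2] on. *)
Let u1 (w : R) : R := clamp (2 - w).
Let u2 (w : R) : R := Num.max 1 (Num.min 2 (1 + w)).

Let u1_ge0 w : 0 <= u1 w. Proof. by have /andP[] := clamp01 (2 - w). Qed.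
Let u1_le1 w : u1 w <= 1. Proof. by have /andP[] := clamp01 (2 - w). Qed.
Let u2_ge1 w : 1 <= u2 w. Proof. by rewrite le_max lexx. Qed.
Let u2_le2 w : u2 w <= 2. Proof. by rewrite ge_max ge_min lexx /= andbT; lra. Qed.
Let u12 w : u1 w <= u2 w. Proof. exact: le_trans (u1_le1 w) (u2_ge1 w). Qed.

(* The filling is parametrised by [w] in [-1, 3].  On [-1, 0] the smallest ring
   shrinks to its marked point; on [0, 1] the latter is transported along [G];
   on [1, 2] the rings stay at the north pole, the point being transported there
   from ever closer to the south pole; on [2, 3] its starting point at the south
   pole escapes far away, where the transport is the identity. *)
Lemma filling_step : exists K, free_filling n.+1 H K.
Proof.
have [T [ctsT offT idT [M farT] eqT]] := transport_exists ctsC disjC.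
have i0 : 0 <= (0 : R) <= 1 by rewrite lexx ler01.
have i1 : 0 <= (1 : R) <= 1 by rewrite lexx ler01.
have [sigma [csig sig0 offsig farsig]] := @escape_path n (C^~ (0, 0)) (q (0, 0)) M
  (offq i0 ler01).
(* Two regimes in one continuous formula: up to [w = 2] the path [sigma] still sits at [q (0, 0)],
   and afterwards [q (s, u1 w)] equals [q (0, 0)], so one of the terms cancels. *)
pose p (s w : R) : point := let v := sigma (Num.max 0 (w - 2)) in
  ((q (s, u1 w)).1.1 + (v.1.1 - (q (0, 0)).1.1),
   (q (s, u1 w)).1.2 + (v.1.2 - (q (0, 0)).1.2),
   (q (s, u1 w)).2 + (v.2 - (q (0, 0)).2)).
have p_le2 s w : w <= 2 -> p s w = q (s, u1 w).
  move=> w2; rewrite /p (max_idPl _) ?subr_le0 // sig0 !subrr !addr0.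
  by case: (q (s, u1 w)) => [[]].
have p_ge2 s w : 2 <= w -> p s w = sigma (w - 2).
  move=> w2; rewrite /p (max_idPr _) ?subr_ge0 // /u1 clamp_le0 ?subr_le0 //.
  by rewrite southq !(addrC _ (_ - _)) !subrK; case: (sigma _) => [[]].
pose th (z : R * R) : point := T z.1 (u1 z.2) (u2 z.2) (p z.1 z.2).
have cu1 : continuous (fun z : R * R => u1 z.2) by rewrite /u1 /clamp; cts.
have cu2 : continuous (fun z : R * R => u2 z.2) by rewrite /u2; cts.
have cth : continuous th.
  apply: ctsT => //; try by cts.
  have cs : continuous (fun z : R * R => sigma (Num.max 0 (z.2 - 2))).
    by apply: (continuous_compose (g := sigma)) csig; cts.
  have cq : continuous (fun z : R * R => q (z.1, u1 z.2)).
    by apply: (continuous_compose (g := q)) ctsq; cts.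
  by rewrite /p; cts.
have off s w : 0 <= s <= 1 -> w <= 3 ->
    forall j, (j < n)%N -> ~ on_ring (C j (s, u2 w)) (th (s, w)).
  move=> s01 w3; apply: offT => // j jn.
  have [w2|w2] := leP w 2; first by rewrite p_le2 //; exact: offq.
  rewrite p_ge2 ?ltW // /u1 clamp_le0 ?subr_le0 ?ltW // southC // -(southC 0 jn).
  by apply: offsig => //=; apply/andP; split; lra.
pose tail (j : nat) (z : R * R) : ring := C j (z.1, u2 z.2).
have ctail j : (j < n)%N -> continuous (tail j).
  by move=> jn; apply: (continuous_compose (g := C j)); [cts|exact: ctsC].
have goodtail z : good_rings n (tail^~ z) by exact: goodC.
pose K0 : set (R * R) := `[0, 1]%classic `*` `[-1, 3]%classic.
have cK0 : compact K0 by apply: compact_setX; exact: segment_compact.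
(* The first margin exceeds the bound [3 * e] of [small_disc_dist], so the disc of a ring of radius
   [e] through [th z] misses the other rings; the second keeps this ring the smallest. *)
have [mu mu0 hmu] : exists2 e : R, 0 < e & forall j t, (j < n)%N -> 0 < t -> t <= e ->
    forall z, K0 z -> 4 * t <= ring_dist (tail j z) (th z) /\ 2 * t <= (tail j z).2.
  apply: (@min_threshold R n (fun j t => forall z, K0 z ->
    4 * t <= ring_dist (tail j z) (th z) /\ 2 * t <= (tail j z).2)) => j jn.
  have ct := ctail j jn.
  have [||a a0 ha] := compact_pos_lbound cK0 (f := fun z => ring_dist (tail j z) (th z)).
  - exact: cts_ring_dist.
  - move=> [s w] [/= sI wI]; rewrite !in_itv /= in sI wI.
    apply/ring_dist_gt0; first exact: (goodtail _).1.
    by apply: off => //; case/andP: wI.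
  have [||b b0 hb] := compact_pos_lbound cK0 (f := fun z => (tail j z).2).
  - by cts.
  - by move=> z _; exact: (goodtail _).1.
  exists (Num.min (a / 4) (b / 2)); first by rewrite lt_min !divr_gt0.
  move=> t t0; rewrite le_min => /andP[ta tb] z K0z.
  by have /= ? := ha z K0z; have /= ? := hb z K0z; split; lra.
pose r0 (s : R) := (H 0 (s, 0)).2.
have cr0 : continuous (fun z : R * R => r0 z.1).
  have := @ctsH 0 isT; rewrite /r0 => cH.
  suff : continuous (fun z : R * R => H 0 (z.1, 0)) by move=> ?; cts.
  by apply: (continuous_compose (g := H 0)); [cts|].
have [nu nu0 hnu] : exists2 e : R, 0 < e & forall s, 0 <= s <= 1 -> e <= r0 s.
  have [||a a0 ha] := compact_pos_lbound cK0 (f := fun z => r0 z.1).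
  - exact: cr0.
  - by move=> z _; exact: (goodH _).1.
  exists a => // s s01; apply: (ha (s, 0)); split => /=; rewrite in_itv //=.
    by rewrite lerN10 ler0n.
pose e := Num.min mu nu / 2.
have [e0 emu enu] : [/\ 0 < e, e <= mu & e <= nu].
  have h : 0 < Num.min mu nu by rewrite lt_min mu0.
  have : Num.min mu nu <= mu by rewrite ge_min lexx.
  have : Num.min mu nu <= nu by rewrite ge_min lexx orbT.
  by rewrite /e; split; lra.
pose rho (z : R * R) := e + Num.max 0 (- z.2) * (r0 z.1 - e).
have rho_ge0 s w : 0 <= w -> rho (s, w) = e.
  by move=> w0; rewrite /rho /= (max_idPl _) ?mul0r ?addr0 // oppr_le0.
have rho_le0 s w : 0 <= s <= 1 -> -1 <= w -> w <= 0 -> e <= rho (s, w) <= r0 s.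
  move=> s01 w1 w0; rewrite /rho /= (max_idPr _) ?oppr_ge0 //.
  by have := hnu s s01; move: (r0 s) => r er; apply/andP; split; nra.
(* Centred so that [th z] is the marked point of the new ring, in the position that [q] has on ring
   0 of [H]. *)
pose head (z : R * R) : ring := ((th z).1.1, (th z).1.2 - rho z, (th z).2, rho z).
have chead : continuous head by rewrite /head /rho; cts.
have th_le0 s w : w <= 0 -> th (s, w) = q (s, 1).
  move=> w0; rewrite /th /=.
  have -> : u1 w = 1 by rewrite /u1 clamp_ge1 //; lra.
  have -> : u2 w = 1.
    by apply/max_idPl; rewrite ge_min; apply/orP; right; lra.
  rewrite idT p_le2; last lra.
  by rewrite /u1 clamp_ge1 //; lra.
pose W (j : nat) z := if j is j'.+1 then tail j' z else head z.
have goodW s w : 0 <= s <= 1 -> -1 <= w <= 3 -> good_rings n.+1 (W^~ (s, w)).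
  move=> s01 /andP[w1 w3].
  have [tr tg] := goodtail (s, w).
  have Kz : K0 (s, w) by split => /=; rewrite in_itv //= w1.
  have erho : e <= rho (s, w).
    have [w0|w0] := leP 0 w; first by rewrite rho_ge0.
    by have /andP[] := rho_le0 s w s01 w1 (ltW w0).
  split=> [[|i] i_n|[|i] [|j] // ij jn]; [|exact: tr| |exact: tg].
    exact: lt_le_trans erho.
  have [h1 h2] := hmu j e jn e0 emu _ Kz.
  have [w0|w0] := leP 0 w.
    rewrite /W /head rho_ge0 //=; split; first lra.
    move=> v /(small_disc_dist (ltW e0)) dv /(on_ring_dist _ (tr j jn)) ov.
    have := ring_dist_lip (tail j (s, w)) (tail j (s, w)) (th (s, w)) v.
    by rewrite ov params_distxx point_distC; lra.
  (* During the shrinking the other rings stand still, and the disc stays inside the initial disc of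
     the smallest ring, which misses them. *)
  have /andP[_ rr] := rho_le0 s w s01 w1 (ltW w0).
  have u2E : u2 w = 1.
    by apply/max_idPl; rewrite ge_min; apply/orP; right; lra.
  have [hr /(_ 0%N j.+1 isT jn)] := goodH s.
  rewrite /W /head /tail /= u2E /C /= lexx subrr clampE // th_le0 ?ltW //.
  rewrite /q /= subrr => -[hlt hd]; split; first exact: le_lt_trans hlt.
  move=> v vd; apply: hd.
  have := @in_disc_shift R (H 0 (s, 0)).1.1.1 (H 0 (s, 0)).1.1.2 (H 0 (s, 0)).1.2
    (r0 s) (rho (s, w)) v (ltW (lt_le_trans e0 erho)) rr.
  by rewrite addrA => /(_ vd); rewrite /r0; case: (H 0 (s, 0)) => [[[]]].
pose phi (z : R * R) : R * R := (clamp z.1, 4 * clamp z.2 - 1).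
have cphi : continuous phi by rewrite /phi /clamp; cts.
exists (fun j z => W j (phi z)); split.
- move=> [|j] jn; first exact: (continuous_compose cphi chead).
  exact: (continuous_compose cphi (ctail j jn)).
- move=> z; apply: goodW; first exact: clamp01.
  by have := clamp01 z.2 => /andP[? ?]; apply/andP; split; lra.
- move=> j s jn s01; rewrite /phi /= (clampE s01) clamp_le0 // mulr0 sub0r.
  case: j jn => [|j] jn; rewrite /W.
    have rho1 : rho (s, -1) = r0 s.
      by rewrite /rho /= opprK (max_idPr ler01) mul1r addrC subrK.
    rewrite /head th_le0 ?lerN10 // rho1.
    by rewrite /q /= subrr /r0 addrK; case: (H 0 (s, 0)) => [[[]]].
  rewrite /tail /= (_ : u2 (-1) = 1); last first.
    by apply/max_idPl; rewrite ge_min; apply/orP; right; lra.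
  by rewrite /C /= lexx subrr clampE.
- move=> j v jn; rewrite /phi /= (clamp_le0 (lexx 0)) (clamp_ge1 (lexx 1)).
  move: (4 * clamp v - 1) => w.
  have hq u : q (0, u) = q (1, u) by rewrite /q /= loopH.
  have hr : r0 0 = r0 1 by rewrite /r0 loopH.
  have eT : T 0 = T 1 by apply: eqT => k u kn; exact: loopC.
  case: j jn => [|j] jn; rewrite /W; last by rewrite /tail /= loopC.
  have -> : head (0, w) = head (1, w); last by [].
  rewrite /head /rho /= hr (_ : th (0, w) = th (1, w)) //.
  by rewrite /th /= eT /p hq.
- move=> j s jn; rewrite /phi /= (clamp_ge1 (lexx 1)).
  have -> : 4 * 1 - 1 = 3 :> R by lra.
  have u23 : u2 3 = 2 by rewrite /u2 (min_idPl _) ?(max_idPr _) //; lra.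
  case: j jn => [|j] jn; rewrite /W; last by rewrite /tail /= u23 !northC.
  have h t : th (clamp t, 3) = sigma 1.
    rewrite /th /= p_ge2; last lra.
    have -> : 3 - 2 = 1 :> R by lra.
    by apply: farT => //; exact: clamp01.
  have i3 : 0 <= 3 :> R by lra.
  by rewrite /head !rho_ge0 // h h.
Qed.
End InductionStep.

Lemma free_filling_exists n (H : nat -> R * R -> ring) :
  (forall j, (j < n)%N -> continuous (H j)) ->
  (forall z, disjoint_rings n (H^~ z)) ->
  (forall s, good_rings n (H^~ (s, 0))) ->
  (forall j v, (j < n)%N -> H j (0, v) = H j (1, v)) ->
  (forall j s, (j < n)%N -> H j (s, 1) = H j (0, 1)) ->
  exists K, free_filling n H K.
Proof.
elim: n H => [|n IH] H cH dH gH lH tH; first by exists H; split.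
have [|||||G fG] := IH (fun j => H j.+1).
- by move=> j jn; exact: cH.
- move=> z; have [r0 d] := dH z.
  by split=> [i i_n|i j i_n jn ij]; [exact: r0|exact: (d i.+1 j.+1)].
- move=> s; have [r0 g] := gH s.
  by split=> [i i_n|i j ij jn]; [exact: r0|exact: (g i.+1 j.+1)].
- by move=> j v jn; exact: lH.
- by move=> j s jn; exact: tH.
exact: filling_step fG.
Qed.

End Filling.

(** * Ordered configurations *)

Section RowVectors.
Variable R : realType.
Local Notation point := (point R).
Local Notation ring := (ring R).

Definition iy : 'I_3 := Ordinal (isT : 1 < 3)%N.
Definition iz : 'I_3 := Ordinal (isT : 2 < 3)%N.

Definition to_point (p : 'rV[R]_3) : point := (p 0 0, p 0 iy, p 0 iz).

Definition of_point (w : point) : 'rV[R]_3 :=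
  \row_i nth 0 [:: w.1.1; w.1.2; w.2] i.

Definition to_ring (a : 'rV[R]_3 * R) : ring := (to_point a.1, a.2).

Definition of_ring (c : ring) : 'rV[R]_3 * R := (of_point c.1, c.2).

Lemma of_pointK : cancel of_point to_point.
Proof. by case=> [[x y] z]; rewrite /to_point !mxE. Qed.

Lemma to_pointK : cancel to_point of_point.
Proof.
move=> p; apply/rowP => -[[|[|[|]]] //= i]; rewrite !mxE /=.
all: by congr (p _ _); apply: val_inj.
Qed.

Lemma of_ringK : cancel of_ring to_ring.
Proof. by case=> c r; rewrite /to_ring of_pointK. Qed.

Lemma to_ringK : cancel to_ring of_ring.
Proof. by case=> c r; rewrite /of_ring to_pointK. Qed.

Lemma yz_ringP a p : yz_ring a p <-> on_ring (to_ring a) (to_point p).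
Proof.
rewrite /yz_ring /on_ring /= !big_ord_recl big_ord0 addr0.
have -> : ord0 = 0 :> 'I_3 by [].
have -> : lift 0 ord0 = iy :> 'I_3 by apply: val_inj.
have -> : lift 0 (lift ord0 ord0) = iz :> 'I_3 by apply: val_inj.
split=> -[e h]; split=> //; first by move: h; rewrite e subrr expr0n add0r.
by rewrite e subrr expr0n add0r.
Qed.

Lemma yz_ring_of_point a w : yz_ring a (of_point w) <-> on_ring (to_ring a) w.
Proof. by rewrite yz_ringP of_pointK. Qed.

Lemma cts_of_point (Z : topologicalType) (f : Z -> point) :
  continuous f -> continuous (fun z => of_point (f z)).
Proof.
move=> cf z; apply/cvg_ballP => e e0.
have h (j : 'I_3) : \forall t \near z, ball (of_point (f z) 0 j) e (of_point (f t) 0 j).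
  have cj : continuous (fun t => of_point (f t) 0 j).
    under [fun _ => _]eq_fun do rewrite mxE.
    case: j => [[|[|[|//]]] ?].
    - exact: (cts_fst (cts_fst cf)).
    - exact: (cts_snd (cts_fst cf)).
    - exact: (cts_snd cf).
  exact: (cvg_ball (cj z)).
near=> t; split=> // i j; rewrite (ord1 i); move: j; near: t.
exact: filter_forall.
Unshelve. all: by end_near. Qed.

Lemma cts_to_point (Z : topologicalType) (f : Z -> 'rV[R]_3) :
  continuous f -> continuous (fun z => to_point (f z)).
Proof.
move=> cf; have c j : continuous (fun z => f z 0 j).
  exact: (continuous_compose cf (@coord_continuous R 1 3 0 j)).
by have := (c 0, c iy, c iz) => -[[? ?] ?]; rewrite /to_point; cts.
Qed.

(** The cap is a paraboloid of height [k]: the flat disc for [k = 0], and otherwise a disc that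
    meets the plane of the ring in the ring only. *)
Lemma cap_bounds (a : 'rV[R]_3 * R) (k : R) : 0 < a.2 ->
  bounds_disc (yz_ring a) ((fun z : R * R =>
    of_point (a.1 0 0 + k * (1 - (z.1 ^+ 2 + z.2 ^+ 2)),
      a.1 0 iy + a.2 * z.1, a.1 0 iz + a.2 * z.2)) @` @closed_disc R).
Proof.
move=> a0; set g := fun z : R * R => _; exists g; split=> //.
- by apply: continuous_subspaceT; apply: cts_of_point; cts.
- move=> [z1 z2] [z1' z2'] _ _ /(congr1 to_point); rewrite !of_pointK /= => -[_].
  by move=> /addrI /(mulfI (negbT (gt_eqF a0))) -> /addrI /(mulfI (negbT (gt_eqF a0))) ->.
- apply/seteqP; split=> [_ [[z1 z2] /= h] <-|p /yz_ringP[/= e h]].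
    apply/yz_ring_of_point; split=> /=; first by rewrite h subrr mulr0 addr0.
    by rewrite !(addrC _ (a.2 * _)) !addrK !exprMn -mulrDr h mulr1.
  have a0' : a.2 != 0 by rewrite gt_eqF.
  pose z1 := (p 0 iy - a.1 0 iy) / a.2; pose z2 := (p 0 iz - a.1 0 iz) / a.2.
  have z12 : z1 ^+ 2 + z2 ^+ 2 = 1.
    by rewrite /z1 /z2 !exprMn -mulrDl h -exprMn divff ?expr1n.
  exists (z1, z2) => //; rewrite /g /= z12 subrr mulr0 addr0 -[RHS]to_pointK.
  by rewrite /to_point e /z1 /z2 !(mulrC a.2) !divfK // !(addrC (a.1 0 _)) !subrK.
Qed.

Lemma unlinked_sym (A B : set 'rV[R]_3) : unlinked A B -> unlinked B A.
Proof. by move=> [D [D' [hD hD' d]]]; exists D', D; split=> //; rewrite setIC. Qed.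

(* The flat disc of [a] misses a paraboloid spanning [b] that bulges away from
   the plane of [a]. *)
Lemma disc_off_ring_unlinked (a b : 'rV[R]_3 * R) : 0 < a.2 -> 0 < b.2 ->
  (forall w, in_disc (to_ring a) w -> on_ring (to_ring b) w -> False) ->
  yz_ring a `&` yz_ring b = set0 /\ unlinked (yz_ring a) (yz_ring b).
Proof.
move=> a0 b0 off; split.
  apply/seteqP; split=> // p [/yz_ringP pa /yz_ringP pb].
  exact: off (on_ring_in_disc pa) pb.
(* With this sign the cap can touch the plane of [a] only when both planes coincide, and then only
   along the ring [b], which [off] excludes from the disc of [a]. *)
pose k : R := if a.1 0 0 <= b.1 0 0 then 1 else - 1.
do 2!eexists; split; [exact: (cap_bounds 0 a0)|exact: (cap_bounds k b0)|].
apply/seteqP; split=> // p [[[z1 z2] hz <-] [[t1 t2] ht]].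
move=> /(congr1 to_point); rewrite !of_pointK /= mul0r addr0 => -[ex ey ez].
rewrite /closed_disc /= in hz ht.
apply: (off (a.1 0 0, a.1 0 iy + a.2 * z1, a.1 0 iz + a.2 * z2)); split=> //=.
- rewrite !(addrC _ (a.2 * _)) !addrK !exprMn -mulrDr.
  by rewrite ler_piMr // exprn_ge0 // ltW.
- move: ex; rewrite /k; case: ifP => [ab|/negbT]; first by lra.
  by rewrite -ltNge; lra.
- have t1E : t1 ^+ 2 + t2 ^+ 2 = 1.
    move: ex; rewrite /k; case: ifP => [ab|/negbT]; first by lra.
    by rewrite -ltNge; lra.
  by rewrite -ey -ez !(addrC _ (b.2 * _)) !addrK !exprMn -mulrDr t1E mulr1.
Qed.

End RowVectors.

Section OrderedConfigurations.
Variables (R : realType) (n : nat).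
Local Notation ring := (ring R).

(** Indexing by [nat] allows the shift of labels in the induction; the ring given outside the range
    is a mere default. *)
Definition ring_family (c : ordered_UR R n) (k : nat) : ring :=
  if insub k is Some i then to_ring (ring_at c i) else (0, 0, 0, 1).

Lemma ring_familyE c (i : 'I_n) : ring_family c i = to_ring (ring_at c i).
Proof. by rewrite /ring_family valK. Qed.

Lemma ring_family_inj c d :
  (forall k, (k < n)%N -> ring_family c k = ring_family d k) -> c = d.
Proof.
move=> h; apply: val_inj; apply: functional_extensionality_dep => i.
have := h i (ltn_ord i); rewrite !ring_familyE => /(can_inj (@to_ringK R)).
exact.
Qed.

Lemma ring_family_disjoint c : disjoint_rings n (ring_family c).
Proof.
have [r0 d] := set_valP c; split=> [k kn|k l kn ln kl w].
  by rewrite (ring_familyE c (Ordinal kn)) /=; exact: r0.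
rewrite (ring_familyE c (Ordinal kn)) (ring_familyE c (Ordinal ln)).
move=> /yz_ring_of_point h /yz_ring_of_point h'.
have [e _] := d (Ordinal kn) (Ordinal ln) kl.
by have : set0 (of_point w) by rewrite -e.
Qed.

Lemma good_ordered_UR (c : nat -> ring) : good_rings n c ->
  ordered_UR_set (fun i : 'I_n => of_ring (c i)).
Proof.
move=> [r0 g]; split=> [i|i j]; first exact: r0.
have h (k l : 'I_n) : (k < l)%N ->
    yz_ring (of_ring (c k)) `&` yz_ring (of_ring (c l)) = set0 /\
    unlinked (yz_ring (of_ring (c k))) (yz_ring (of_ring (c l))).
  move=> kl; apply: disc_off_ring_unlinked; [exact: r0|exact: r0|].
  by rewrite !of_ringK; exact: (g k l kl (ltn_ord l)).2.
rewrite -(inj_eq val_inj) neq_ltn => /orP[|] /h // [e u].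
by split; [rewrite setIC|exact: unlinked_sym].
Qed.

Definition of_family (c : nat -> ring) (gc : good_rings n c) : ordered_UR R n :=
  @exist _ (fun x => x \in @ordered_UR_set R n) _ (mem_set (good_ordered_UR gc)).

Lemma of_familyE c (gc : good_rings n c) k : (k < n)%N ->
  ring_family (of_family gc) k = c k.
Proof.
by move=> kn; rewrite (ring_familyE _ (Ordinal kn)) /ring_at /= set_valE /= of_ringK.
Qed.

Lemma cts_ring_at (i : 'I_n) : continuous (fun c : ordered_UR R n => ring_at c i).
Proof.
apply: (continuous_compose (f := set_val) (g := fun c : prod_topology _ => c i)).
  exact: initial_continuous.
exact: proj_continuous.
Qed.

Lemma cts_ring_family k : (k < n)%N ->
  continuous (fun c : ordered_UR R n => ring_family c k).
Proof.
move=> kn; rewrite (_ : (fun c => _) = fun c => to_ring (ring_at c (Ordinal kn))).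
  have := @cts_ring_at (Ordinal kn) => h; rewrite /to_ring; apply: continuous_pair.
    by apply: cts_to_point; cts.
  by cts.
by apply/funext => c; rewrite -ring_familyE.
Qed.

Lemma cts_ordered_UR (Z : topologicalType) (f : Z -> ordered_UR R n) :
  (forall k, (k < n)%N -> continuous (fun z => ring_family (f z) k)) ->
  continuous f.
Proof.
move=> cf; apply: continuous_comp_initial => z; apply/cvg_sup => i.
apply: (@continuous_comp_initial _ _ _ (fun g : forall i : 'I_n, ('rV[R]_3 * R)%type => g i)
  (fun z => set_val (f z))).
rewrite (_ : _ \o _ = fun z => of_ring (ring_family (f z) i)).
  have := cf i (ltn_ord i) => h; rewrite /of_ring; apply: continuous_pair.
    by apply: cts_of_point; cts.
  by cts.
by apply/funext => t /=; rewrite ring_familyE to_ringK.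
Qed.

End OrderedConfigurations.

(** * Lifting squares to ordered configurations *)

Section Lifting.
Variables (R : realType) (n : nat).
Local Notation ring := (ring R).
Local Notation conf := (ordered_UR R n).
Implicit Types (c d : conf) (s : 'S_n).

Definition ring_of c (i : 'I_n) : ring := to_ring (ring_at c i).

Lemma cts_ring_of i : continuous (ring_of^~ i).
Proof.
by move=> c; have := @cts_ring_family R n i (ltn_ord i) c; under eq_fun do rewrite ring_familyE.
Qed.

Lemma relabel_subproof s c :
  ordered_UR_set (fun i => ring_at c (s i)).
Proof.
have [r0 d] := set_valP c; split=> [i|i j ij]; first exact: r0.
by apply: d; rewrite (inj_eq perm_inj).
Qed.

Definition relabel s c : conf :=
  @exist _ (fun x => x \in @ordered_UR_set R n) _ (mem_set (relabel_subproof s c)).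

Lemma relabelE s c i : ring_of (relabel s c) i = ring_of c (s i).
Proof. by []. Qed.

Lemma ring_of_inj c d : ring_of c =1 ring_of d -> c = d.
Proof.
move=> h; apply: ring_family_inj => k kn.
by rewrite (ring_familyE c (Ordinal kn)) (ring_familyE d (Ordinal kn)); exact: h.
Qed.

Lemma pi_relabel s c : \pi_(UR R n) (relabel s c) = \pi_(UR R n) c.
Proof.
apply/eqmodP/asboolP; exists s^-1%g => i.
by rewrite -{1}[i](permKV s).
Qed.

Lemma pi_eqP c d : \pi_(UR R n) c = \pi_(UR R n) d -> exists s, d = relabel s c.
Proof.
move=> /eqmodP /asboolP[s h]; exists s; apply: ring_of_inj => i.
by rewrite relabelE /ring_of h.
Qed.

Definition near_conf (e : R) c d : Prop :=
  forall i, params_dist (ring_of c i) (ring_of d i) < e.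

Lemma cts_near_conf (Z : topologicalType) (f : Z -> conf) z (e : R) :
  continuous f -> 0 < e -> \forall z' \near z, near_conf e (f z) (f z').
Proof.
move=> cf e0; apply: filter_forall => i.
have cg : continuous (fun z' => params_dist (ring_of (f z) i) (ring_of (f z') i)).
  have h : continuous (fun z' => ring_of (f z') i).
    exact: (continuous_compose cf (@cts_ring_of i)).
  by rewrite /params_dist /point_dist; cts.
move: (cg z) => /cvgr_lt; apply.
by rewrite params_distxx.
Qed.

Lemma near_conf_cts (Z : topologicalType) (f : Z -> conf) :
  (forall z (e : R), 0 < e -> \forall z' \near z, near_conf e (f z) (f z')) ->
  continuous f.
Proof.
move=> h; apply: cts_ordered_UR => k kn z; apply/cvg_ballP => e e0.
have := h z e e0; apply: filterS => z' /(_ (Ordinal kn)).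
rewrite (ring_familyE _ (Ordinal kn)) (ring_familyE _ (Ordinal kn)) -!/(ring_of _ _).
move: (ring_of _ _) (ring_of _ _) => b a; rewrite /params_dist /point_dist => ab.
have := normr_ge0 (a.1.1.1 - b.1.1.1); have := normr_ge0 (a.1.1.2 - b.1.1.2).
have := normr_ge0 (a.1.2 - b.1.2); have := normr_ge0 (a.2 - b.2).
by move=> *; (do !split); rewrite /ball /=; lra.
Qed.

Lemma rings_distinct c i j : i != j -> 0 < params_dist (ring_of c i) (ring_of c j).
Proof.
move=> ij; rewrite lt_def params_dist_ge0 andbT; apply/eqP => /params_dist_eq0 e.
have [r0 d] := ring_family_disjoint c.
have := d i j (ltn_ord i) (ltn_ord j) ij; rewrite !ring_familyE -!/(ring_of _ _) e.
move: (ring_of c j) => [[[x y] z] r] /(_ (x, y + r, z)); apply; split=> //=.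
all: by rewrite subrr expr0n addr0 addrC addKr.
Qed.

Lemma gap_exists c : exists2 g : R, 0 < g &
  forall i j, i != j -> g <= params_dist (ring_of c i) (ring_of c j).
Proof.
exists (\big[Num.min/1]_(p : 'I_n * 'I_n | p.1 != p.2)
  params_dist (ring_of c p.1) (ring_of c p.2)).
  by apply: lt_bigmin => // -[i j] /= ij; exact: rings_distinct.
move=> i j ij; exact: (@bigmin_le_cond _ _ _ _ (i, j) (fun p => p.1 != p.2)).
Qed.

(* Relatively to the gaps of [c], the configuration [d] is close to [c]. *)
Definition close_conf (a : R) c d : Prop := forall i j, i != j ->
  a * params_dist (ring_of c i) (ring_of d i) < params_dist (ring_of c i) (ring_of c j).

(** If a relabelling [s] moved [i], ring [s i] of [d] would be nearer than half their gap to both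
    ring [i] and ring [s i] of [c]. Lifting steps use the factor 4 in place of 2, to survive a small
    perturbation of both configurations. *)
Lemma close_conf_unique c d d' : \pi_(UR R n) d = \pi_(UR R n) d' ->
  close_conf 2 c d -> close_conf 2 c d' -> d = d'.
Proof.
move=> /pi_eqP[s ->] cd cd'; apply: ring_of_inj => i; rewrite relabelE.
have [->//|si] := eqVneq (s i) i.
have h1 : 2 * params_dist (ring_of c (s i)) (ring_of d (s i)) <
    params_dist (ring_of c i) (ring_of c (s i)).
  by rewrite [ltRHS]params_distC; exact: cd.
have h2 := cd' i (s i); rewrite eq_sym relabelE in h2; have {}h2 := h2 si.
have h3 := params_dist_triangle (ring_of d (s i)) (ring_of c i) (ring_of c (s i)).
rewrite (params_distC (ring_of d (s i)) (ring_of c (s i))) in h3.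
by exfalso; lra.
Qed.

Lemma close_conf_refl c : close_conf 4 c c.
Proof. by move=> i j ij; rewrite params_distxx mulr0 rings_distinct. Qed.

Lemma close_confW c d : close_conf 4 c d -> close_conf 2 c d.
Proof.
move=> h i j ij; apply: le_lt_trans (h i j ij).
by have := params_dist_ge0 (ring_of c i) (ring_of d i); lra.
Qed.

(** The quotient map is open: the preimage of the image of a neighbourhood is the union of its
    relabellings. *)
Lemma local_lift (Z : topologicalType) (h : Z -> UR R n) z c (e : R) :
  continuous h -> \pi_(UR R n) c = h z -> 0 < e ->
  \forall z' \near z, exists2 d, \pi_(UR R n) d = h z' & near_conf e c d.
Proof.
move=> ch cz e0.
pose U : set (UR R n) := [set u | exists2 d, \pi_(UR R n) d = u & near_conf e c d].
suff oU : open U.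
  have : nbhs (h z) U -> \forall z' \near z, U (h z') by exact: (ch z).
  apply; apply: open_nbhs_nbhs; split=> //; exists c => // i.
  by rewrite params_distxx.
have near_open d s : near_conf e c (relabel s d) ->
    nbhs d [set d1 | near_conf e c (relabel s d1)].
  move=> cd.
  suff near1 i : nbhs d [set d1 | params_dist (ring_of c i) (ring_of d1 (s i)) < e].
    exact: (@filter_forall _ _ _ _ _ near1).
  have cg : continuous (fun d1 => params_dist (ring_of c i) (ring_of d1 (s i))).
    by have := @cts_ring_of (s i) => ?; rewrite /params_dist /point_dist; cts.
  by move: (cg d) => /cvgr_lt; apply; exact: cd.
rewrite /open /= /quotient_open openE => d /= [d' dd' cd'].
have [s d'E] := pi_eqP (esym dd'); rewrite {}d'E in cd'.
apply: filterS (near_open d s cd') => d1 h1.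
by exists (relabel s d1) => //; exact: pi_relabel.
Qed.

(** [close_conf] is unchanged when both arguments are relabelled alike, so estimates around one lift
    of [h x] serve all lifts [c] of [h y]. *)
Lemma uniform_lift (h : R * R -> UR R n) (K : set (R * R)) :
  compact K -> continuous h ->
  exists2 d : R, 0 < d & forall y z, K y -> ball y d z ->
    forall c, \pi_(UR R n) c = h y ->
    exists2 c', \pi_(UR R n) c' = h z & close_conf 4 c c'.
Proof.
move=> cK ch; apply: (lebesgue_number (P := fun y z => forall c,
  \pi_(UR R n) c = h y -> exists2 c', \pi_(UR R n) c' = h z & close_conf 4 c c') cK).
move=> x _; have [g g0 gP] := gap_exists (repr (h x)).
have g0' : 0 < g / 20 by rewrite divr_gt0.
have [e /= e0 eP] := (@nbhs_ballP _ _ _ _).1 (local_lift ch (reprK (h x)) g0').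
exists e => // y z xy xz c cy.
have [c1 c1y c1P] := eP y xy; have [d dz dP] := eP z xz.
have [s cE] := pi_eqP (etrans c1y (esym cy)).
exists (relabel s d); first by rewrite -dz pi_relabel.
move=> i j ij; rewrite cE !relabelE.
have sij : s i != s j by rewrite (inj_eq perm_inj).
move: (s i) (s j) sij => k l kl.
have a1 := c1P k; have a2 := c1P l; have a3 := dP k; have a4 := gP k l kl.
move: (ring_of (repr _) _) (ring_of (repr _) _) a1 a2 a3 a4 => r2 r1 a1 a2 a3 a4.
have b1 := params_dist_triangle r1 (ring_of c1 k) (ring_of d k).
have b2 := params_dist_triangle (ring_of c1 k) r1 r2.
have b3 := params_dist_triangle (ring_of c1 l) (ring_of c1 k) r2.
rewrite (params_distC (ring_of c1 k) r1) in b1.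
rewrite (params_distC (ring_of c1 l) r2) in b3.
lra.
Qed.

Definition lift_step (u : UR R n) c : conf :=
  if pselect (exists d, \pi_(UR R n) d = u /\ close_conf 4 c d) is left p
  then projT1 (cid p) else c.

Lemma lift_stepP u c : (exists2 d, \pi_(UR R n) d = u & close_conf 4 c d) ->
  \pi_(UR R n) (lift_step u c) = u /\ close_conf 4 c (lift_step u c).
Proof.
move=> [d du cd]; rewrite /lift_step; case: pselect => [p|np]; last first.
  by case: np; exists d.
by case: cid.
Qed.

(** Uniqueness of close lifts makes the choice continuous: the lift near [lift_step (h z) (f z)]
    that [local_lift] provides over [z'] is also close to [f z'], hence it is the chosen one. *)
Lemma lift_step_cts (Z : topologicalType) (h : Z -> UR R n) (f : Z -> conf) :
  continuous h -> continuous f ->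
  (forall z, exists2 d, \pi_(UR R n) d = h z & close_conf 4 (f z) d) ->
  continuous (fun z => lift_step (h z) (f z)).
Proof.
move=> ch cf ex; apply: near_conf_cts => z e e0.
have [dz cz] := lift_stepP (ex z).
set d0 := lift_step (h z) (f z) in dz cz *.
have [g g0 gP] := gap_exists (f z).
(* Of the gap, [close_conf 4] leaves one half for the perturbations, which add up to [6 * e']; so
   [e'] must not exceed [g / 12]. *)
pose e' := Num.min e (g / 13).
have e'0 : 0 < e' by rewrite lt_min e0 divr_gt0.
have e'e : e' <= e by rewrite ge_min lexx.
have e'g : e' <= g / 13 by rewrite ge_min lexx orbT.
have N1 := local_lift ch dz e'0.
have N2 := cts_near_conf z cf e'0.
near=> z'.
have [d dz' d0d] : exists2 d, \pi_(UR R n) d = h z' & near_conf e' d0 d by near: z'.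
have ff : near_conf e' (f z) (f z') by near: z'.
have [d1z' c1] := lift_stepP (ex z').
suff <- : d = lift_step (h z') (f z') by move=> i; exact: lt_le_trans (d0d i) e'e.
apply: (@close_conf_unique (f z')); [by rewrite dz'|move=> i j ij|exact: close_confW].
have a1 := ff i; have a2 := ff j; have a3 := d0d i; have a4 := gP i j ij.
have a5 := cz i j ij.
have b1 := params_dist_triangle (ring_of (f z) i) (ring_of (f z') i) (ring_of d i).
have b2 := params_dist_triangle (ring_of d0 i) (ring_of (f z) i) (ring_of d i).
have b3 := params_dist_triangle (ring_of (f z') i) (ring_of (f z) i) (ring_of (f z) j).
have b4 := params_dist_triangle (ring_of (f z') j) (ring_of (f z') i) (ring_of (f z) j).
rewrite (params_distC (ring_of (f z') i) (ring_of (f z) i)) in b1.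
rewrite (params_distC (ring_of (f z') j) (ring_of (f z) j)) in b4.
lra.
Unshelve. all: by end_near. Qed.

(** The square is lifted along rays from the corner: [f k] lifts [h] composed with the contraction
    of ratio [k / N], starting from the constant [c0]. All points advance together, so no gluing of
    local lifts occurs. *)
Lemma square_lift (h : R * R -> UR R n) c0 : continuous h ->
  \pi_(UR R n) c0 = h (0, 0) ->
  exists f : R * R -> conf, [/\ continuous f, f (0, 0) = c0 &
    forall z, \pi_(UR R n) (f z) = h (clamp z.1, clamp z.2)].
Proof.
move=> ch h0.
pose K : set (R * R) := `[0, 1]%classic `*` `[0, 1]%classic.
have cK : compact K by apply: compact_setX; exact: segment_compact.
have [d d0 dP] := uniform_lift cK ch.
pose N := (Num.truncn (1 / d)).+1.
have N0 : 0 < N%:R :> R by rewrite ltr0n.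
have Nd : 1 / N%:R < d.
  have : 1 / d < N%:R by exact: truncnS_gt.
  by rewrite !ltr_pdivrMr // mulrC.
pose t (k : nat) (z : R * R) : R * R :=
  (k%:R / N%:R * clamp z.1, k%:R / N%:R * clamp z.2).
have ct k : continuous (t k) by rewrite /t /clamp; cts.
have Kt k z : (k <= N)%N -> K (t k z).
  move=> kN; have kN1 : 0 <= (k%:R / N%:R : R) <= 1.
    apply/andP; split; first exact: divr_ge0.
    by rewrite ler_pdivrMr // mul1r ler_nat.
  have /andP[? ?] := clamp01 z.1; have /andP[? ?] := clamp01 z.2.
  have /andP[? ?] := kN1.
  by split=> /=; rewrite in_itv /= mulr_ge0 //= mulr_ile1.
have tt k z : ball (t k z) d (t k.+1 z).
  have e (a : R) : 0 <= a <= 1 -> `|k%:R / N%:R * a - k.+1%:R / N%:R * a| < d.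
    move=> /andP[a0 a1]; rewrite -mulrBl -mulrBl -[k.+1%:R]natr1 opprD addNKr.
    rewrite normrM (ger0_norm a0) normrM normrN normr1 gtr0_norm ?invr_gt0 //.
    by apply: le_lt_trans Nd; rewrite ler_piMr // mul1r invr_ge0 ltW.
  by split; apply: e; exact: clamp01.
pose f := fix f (k : nat) (z : R * R) : conf :=
  if k is k'.+1 then lift_step (h (t k z)) (f k' z) else c0.
have fP k : (k <= N)%N -> [/\ continuous (f k), f k (0, 0) = c0 &
    forall z, \pi_(UR R n) (f k z) = h (t k z)].
  elim: k => [|k IH] kN.
    by split=> //= [|z]; [exact: cts_cst|rewrite h0 /t !mul0r].
  have [cf f0 fh] := IH (ltnW kN).
  have ex z : exists2 d, \pi_(UR R n) d = h (t k.+1 z) & close_conf 4 (f k z) d.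
    by apply: (dP (t k z)); [apply: Kt; exact: ltnW|exact: tt|exact: fh].
  split=> /= [||z]; last exact: (lift_stepP (ex z)).1.
    by apply: lift_step_cts => //; exact: (continuous_compose (ct k.+1) ch).
  have [e1 e2] := lift_stepP (ex (0, 0)); rewrite f0 in e1 e2 *.
  apply: (@close_conf_unique c0); last exact/close_confW/close_conf_refl.
    by rewrite e1 h0 /t /= (clamp_le0 (lexx 0)) !mulr0.
  exact: close_confW.
have [cf f0 fh] := fP N (leqnn N).
by exists (f N); split=> // z; rewrite fh /t divff ?gt_eqF // !mul1r.
Qed.

End Lifting.

(** * Fundamental groups *)

Section FreeNullHomotopy.
Variables (R : realType) (X : topologicalType) (x : X).
Local Notation I := (unit_interval R).

(** The loop is first deformed into the path [g], which follows the trajectory [W (0, _)] of the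
    base point and comes back; [g] is then retracted along itself. *)
Lemma free_null_homotopic (p : {path I from x to x in X}) (W : R * R -> X) :
  continuous W -> (forall t, W (ival t, 0) = p t) ->
  (forall v, W (0, v) = W (1, v)) -> (forall s, W (s, 1) = W (0, 1)) ->
  path_homotopic p (cst x : {path I from x to x in X}).
Proof.
move=> cW Wp Wl Wt.
have W0 : W (0, 0) = x by rewrite -{1}ival_zero Wp path_zero.
have c1 : continuous (fun ts : I * I => ival ts.1) by exact: continuous_ival1.
have c2 : continuous (fun ts : I * I => ival ts.2) by exact: continuous_ival2.
(* The slope 3 reserves the outer thirds for the two sides of the square, the middle third for its
   constant top. *)
pose tent (s : R) : R := 3 * Num.min s (1 - s).
have tent0 : tent 0 = 0 by rewrite /tent subr0 (min_idPl ler01) mulr0.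
have tent1 : tent 1 = 0 by rewrite /tent subrr (min_idPr ler01) mulr0.
have tent_ge0 (t : I) : 0 <= tent (ival t).
  by have /andP[? ?] := ivalP t; rewrite mulr_ge0 // le_min subr_ge0; apply/andP.
pose g (t : I) := W (0, Num.min 1 (tent (ival t))).
have cg : continuous g.
  apply: (continuous_compose (g := W)) cW; have ci := @continuous_ival R.
  by rewrite /tent; cts.
have g0 : g zero = x by rewrite /g ival_zero tent0 (min_idPr ler01).
have g1 : g one = x by rewrite /g ival_one tent1 (min_idPr ler01).
apply: (@path_homotopic_trans _ _ _ _ (mk_path cg g0 g1)).
- exists (fun ts => W (clamp (ival ts.1 + 2 * ival ts.1 * ival ts.2 - ival ts.2),
    Num.min (ival ts.2) (tent (ival ts.1)))); split.
  + by apply: (continuous_compose (g := W)) cW; rewrite /clamp /tent; cts.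
  + move=> t; rewrite /= ival_zero mulr0 addr0 subr0 clampE ?ivalP //.
    by rewrite (min_idPl (tent_ge0 t)).
  + move=> t; rewrite /= /mk_path /= /g ival_one mulr1.
    have /andP[s0 s1] := ivalP t; move: (ival t) s0 s1 => s s0 s1.
    have [l1|l1] := leP s 3^-1; first by rewrite clamp_le0 //; lra.
    have [l2|l2] := leP 1 (3 * (1 - s)); last by rewrite clamp_ge1 ?Wl //; lra.
    rewrite (min_idPl _) ?Wt // /tent /Num.min; case: ifP => _; lra.
  + move=> s; have /andP[s0 s1] := ivalP s; rewrite /= ival_zero ival_one.
    rewrite tent0 tent1 (min_idPr s0) clamp_le0 ?clamp_ge1 -?Wl; [by []|lra|lra].
- exists (fun ts => W (0, Num.min (1 - ival ts.2) (tent (ival ts.1)))); split.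
  + by apply: (continuous_compose (g := W)) cW; rewrite /tent; cts.
  + by move=> t; rewrite /= ival_zero subr0.
  + by move=> t; rewrite /= ival_one subrr (min_idPl (tent_ge0 t)).
  + move=> s; have /andP[_ s1] := ivalP s; rewrite /= ival_zero ival_one.
    by rewrite tent0 tent1 (min_idPr _) ?subr_ge0.
Qed.

End FreeNullHomotopy.

(** * Labelling the rings by increasing radius *)

Section Radii.
Variables (R : realType) (n : nat).
Local Notation conf := (ordered_UR R n).
Implicit Types (c d : conf).

Lemma sorting_perm (f : 'I_n -> R) : injective f ->
  exists s : 'S_n, forall i j : 'I_n, (i < j)%N -> f (s i) < f (s j).
Proof.
move=> finj; pose le := relpre f <=%O.
pose e := sort le (enum 'I_n).
have se : size e = n by rewrite size_sort size_enum_ord.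
have ue : uniq e by rewrite sort_uniq enum_uniq.
have x0 (i : 'I_n) : 'I_n := i.
have inj : injective (fun i : 'I_n => nth i e i).
  move=> i j; rewrite (set_nth_default i j) ?se //.
  by move=> /eqP; rewrite nth_uniq ?se // => /eqP /val_inj.
exists (perm inj) => i j ij; rewrite !permE (set_nth_default i j) ?se //.
rewrite lt_neqAle (inj_eq finj) nth_uniq ?se // ltn_eqF //=.
apply: (@sorted_ltn_nth _ le _ i e _ i j) => //; rewrite ?inE ?se //.
  by move=> a b c; exact: le_trans.
by apply: sort_sorted => a b; exact: le_total.
Qed.

Definition increasing_radii c : Prop :=
  forall i j : 'I_n, (i < j)%N -> (ring_at c i).2 < (ring_at c j).2.

Lemma increasing_good c : increasing_radii c -> good_rings n (ring_family c).
Proof.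
move=> incr; apply: disjoint_increasing_good; first exact: ring_family_disjoint.
move=> i j ij jn; have i_n := ltn_trans ij jn.
rewrite (ring_familyE c (Ordinal i_n)) (ring_familyE c (Ordinal jn)).
exact: incr.
Qed.

Lemma good_increasing c : good_rings n (ring_family c) -> increasing_radii c.
Proof.
by move=> [_ g] i j ij; have [] := g i j ij (ltn_ord j); rewrite !ring_familyE.
Qed.

Lemma increasing_inj c : increasing_radii c ->
  injective (fun i => 2 * (ring_at c i).2).
Proof.
move=> incr i j /(mulfI (negbT (gt_eqF (ltr0Sn _ 1)))) e.
by case: (ltngtP i j) => [/incr|/incr|/val_inj //]; rewrite e ltxx.
Qed.

Lemma incr_ord_ge (s : 'I_n -> 'I_n) :
  (forall i j : 'I_n, (i < j)%N -> (s i < s j)%N) -> forall i : 'I_n, (i <= s i)%N.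
Proof.
move=> incr [m mn]; elim: m mn => //= m IH mn.
have mn' := ltnW mn.
exact: leq_ltn_trans (IH mn') (incr (Ordinal mn') (Ordinal mn) (ltnSn m)).
Qed.

(** The permutation relating two increasing labellings is increasing, as is its inverse; by
    [incr_ord_ge] for both, it is the identity. This closes up the lifted square. *)
Lemma increasing_lift_unique c d : \pi_(UR R n) c = \pi_(UR R n) d ->
  increasing_radii c -> increasing_radii d -> c = d.
Proof.
move=> /pi_eqP[s ->] ci di; apply: ring_of_inj => i; rewrite relabelE; congr ring_of.
have mono (j k : 'I_n) : (j < k)%N -> (s j < s k)%N.
  move=> jk; have h : (ring_at c (s j)).2 < (ring_at c (s k)).2 := di j k jk.
  rewrite ltnNge leq_eqVlt; apply/negP => /orP[/eqP/val_inj e|/ci].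
    by rewrite e ltxx in h.
  by rewrite ltNge => /negP; apply; exact: ltW.
have mono' (j k : 'I_n) : (j < k)%N -> (s^-1%g j < s^-1%g k)%N.
  move=> jk; rewrite ltnNge leq_eqVlt; apply/negP => /orP[/eqP/val_inj/perm_inj e|/mono].
    by rewrite e ltnn in jk.
  by rewrite !permKV ltnNge ltnW.
apply: val_inj; apply/eqP; rewrite eqn_leq incr_ord_ge //=.
by have := incr_ord_ge mono' (s i); rewrite permK.
Qed.

Lemma UR_lt_distinct c i j : UR_lt_set (\pi_(UR R n) c) -> i != j ->
  (ring_at c i).2 != (ring_at c j).2.
Proof.
move=> [d /pi_eqP[s ->] dinj]; apply: contra_neq => e; apply: (@perm_inj _ s); apply: dinj.
exact: (congr1 (fun r => 2 * r) e).
Qed.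

(** Along such a path no difference of two radii vanishes, so by the intermediate value theorem each
    keeps its sign. *)
Lemma increasing_along (f : R -> conf) : continuous f ->
  (forall t, 0 <= t <= 1 -> UR_lt_set (\pi_(UR R n) (f t))) ->
  increasing_radii (f 0) -> forall t, 0 <= t <= 1 -> increasing_radii (f t).
Proof.
move=> cf fU f0 t /andP[t0 t1] i j ij.
pose g u := (ring_at (f u) j).2 - (ring_at (f u) i).2.
have cr k : continuous (fun u => (ring_at (f u) k).2).
  by apply: cts_snd; exact: (continuous_compose cf (@cts_ring_at R n k)).
have cg : continuous g by apply: cts_add (cr j) (cts_opp (cr i)).
rewrite -subr_gt0 -/(g t) ltNge; apply/negP => gt.
have g0 : 0 < g 0 by rewrite subr_gt0; exact: f0.
have [||u] := @IVT R g 0 t 0 t0; first exact: continuous_subspaceT.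
  by rewrite ge_min le_max gt orbT (ltW g0).
rewrite in_itv /= => /andP[u0 ut] /eqP; rewrite subr_eq0.
apply/negP; apply: UR_lt_distinct; last by rewrite -(inj_eq val_inj) gtn_eqF.
by apply: fU; rewrite u0 (le_trans ut t1).
Qed.

End Radii.

(** * Triviality of the kernel *)

Section Kernel.
Variables (R : realType) (n : nat) (c : UR_lt R n).
Local Notation I := (unit_interval R).

Lemma null_homotopic_UR_lt (p : {path I from c to c in UR_lt R n}) :
  path_homotopic (path_image (UR_lt_incl R n) p)
    (cst (UR_lt_incl R n c) : {path I from UR_lt_incl R n c to UR_lt_incl R n c in UR R n}) ->
  path_homotopic p (cst c : {path I from c to c in UR_lt R n}).
Proof.
move=> [H [cH Hp Ht Hlr]].
pose h (z : R * R) := H (clampI z.1, clampI z.2).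
have ch : continuous h.
  apply: (continuous_compose (g := H)) cH; apply: continuous_pair.
    by apply: (continuous_compose (g := @clampI R)); [cts|exact: continuous_clampI].
  by apply: (continuous_compose (g := @clampI R)); [cts|exact: continuous_clampI].
have h0 s : h (s, 0) = UR_lt_incl R n (p (clampI s)) by rewrite /h clampI0 Hp.
have h1 s : h (s, 1) = UR_lt_incl R n c by rewrite /h clampI1 Ht.
have hl v : h (0, v) = UR_lt_incl R n c by rewrite /h clampI0 (Hlr _).1.
have hr v : h (1, v) = UR_lt_incl R n c by rewrite /h clampI1 (Hlr _).2.
have inU (a : UR_lt R n) : UR_lt_set (UR_lt_incl R n a) by exact: set_valP.
have [c1 c1c c1inj] := inU c.
have [s0 s0P] : exists s : 'S_n, forall i j : 'I_n, (i < j)%N ->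
    (ring_at c1 (s i)).2 < (ring_at c1 (s j)).2.
  apply: (sorting_perm (f := fun i => (ring_at c1 i).2)) => i j e.
  by apply: c1inj; rewrite /= e.
pose c0 := relabel s0 c1.
have c0c : \pi_(UR R n) c0 = UR_lt_incl R n c by rewrite pi_relabel.
have [|f [cf f00 fh]] := square_lift (c0 := c0) ch; first by rewrite hl.
have k01 : forall t : R, 0 <= t <= 1 -> clamp t = t by exact: clampE.
have i0 : 0 <= (0 : R) <= 1 by rewrite lexx ler01.
have i1 : 0 <= (1 : R) <= 1 by rewrite lexx ler01.
have cfl (a b : R -> R) : continuous a -> continuous b ->
    continuous (fun t => f (a t, b t)).
  by move=> ca cb; apply: (continuous_compose (g := f)) cf; cts.
have bot s : 0 <= s <= 1 -> increasing_radii (f (s, 0)).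
  apply: (increasing_along (f := fun s => f (s, 0))).
  - by apply: cfl; cts.
  - by move=> t t01; rewrite fh /= !k01 // h0; exact: inU.
  - by rewrite f00; exact: s0P.
have left v : 0 <= v <= 1 -> increasing_radii (f (0, v)).
  apply: (increasing_along (f := fun v => f (0, v))).
  - by apply: cfl; cts.
  - by move=> t t01; rewrite fh /= !k01 // hl; exact: inU.
  - exact: bot.
have right v : 0 <= v <= 1 -> increasing_radii (f (1, v)).
  apply: (increasing_along (f := fun v => f (1, v))).
  - by apply: cfl; cts.
  - by move=> t t01; rewrite fh /= !k01 // hr; exact: inU.
  - exact: bot.
have top s : 0 <= s <= 1 -> increasing_radii (f (s, 1)).
  apply: (increasing_along (f := fun s => f (s, 1))).
  - by apply: cfl; cts.
  - by move=> t t01; rewrite fh /= !k01 // h1; exact: inU.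
  - exact: left.
pose F (j : nat) (z : R * R) := ring_family (f (clamp z.1, clamp z.2)) j.
have [K [cK gK K0 Kl Kt]] : exists K, free_filling n F K.
  apply: free_filling_exists.
  - move=> j jn; apply: (continuous_compose (f := fun z : R * R => f (clamp z.1, clamp z.2))
      (g := fun d => ring_family d j)); last exact: cts_ring_family.
    by apply: (continuous_compose (g := f)) cf; rewrite /clamp; cts.
  - by move=> z; exact: ring_family_disjoint.
  - move=> s; apply: increasing_good; rewrite /= (k01 _ i0).
    by apply: bot; exact: clamp01.
  - move=> j v jn; rewrite /F /= (k01 _ i0) (k01 _ i1).
    (* Both sides of the square lie over the base point with increasing labels, so the lift has no
       monodromy. *)
    have e : f (0, clamp v) = f (1, clamp v); last by rewrite e.
    apply: increasing_lift_unique; [|exact/left/clamp01|exact/right/clamp01].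
    by rewrite !fh /= (k01 _ i0) (k01 _ i1) hl hr.
  - move=> j s jn; rewrite /F /= (k01 _ i0) (k01 _ i1).
    have e : f (clamp s, 1) = f (0, 1); last by rewrite e.
    apply: increasing_lift_unique; [|exact/top/clamp01|exact/left].
    by rewrite !fh /= (k01 _ i0) (k01 _ i1) h1 hl.
pose w z := of_family (gK z).
have wE z j : (j < n)%N -> ring_family (w z) j = K j z by exact: of_familyE.
have wU z : UR_lt_set (\pi_(UR R n) (w z)).
  exists (w z) => //; apply/increasing_inj/good_increasing.
  have [r0 g] := gK z; split=> [i i_n|i j ij jn]; first by rewrite wE //; exact: r0.
  by rewrite !wE ?(ltn_trans ij jn) //; exact: g.
pose W z : UR_lt R n := @exist _ (fun u => u \in @UR_lt_set R n) _ (mem_set (wU z)).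
have WE z z' : (forall j, (j < n)%N -> K j z = K j z') -> W z = W z'.
  move=> e; apply: val_inj => /=; congr (\pi_(UR R n) _).
  by apply: ring_family_inj => j jn; rewrite !wE ?e.
have cW : continuous W.
  apply: continuous_comp_initial.
  apply: (continuous_compose (f := w) (g := fun d => \pi_(UR R n) d)).
    apply: cts_ordered_UR => j jn.
    rewrite (_ : (fun z => _) = K j); first exact: cK.
    by apply/funext => z; rewrite wE.
  exact: (@pi_continuous _ _ : continuous (fun d : ordered_UR R n => \pi_(UR R n) d)).
apply: (free_null_homotopic cW).
- move=> t; apply: val_inj; have t01 := ivalP t.
  have -> : val (p t) = h (ival t, 0) by rewrite h0 clampIK.
  transitivity (\pi_(UR R n) (f (ival t, 0))); last by rewrite fh /= !k01.
  congr (\pi_(UR R n) _); apply: ring_family_inj => j jn.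
  by rewrite wE // K0 // /F /= !k01.
- by move=> v; apply: WE => j jn; exact: Kl.
- by move=> s; apply: WE => j jn; exact: Kt.
Qed.

End Kernel.

Theorem proposition4p4 (R : realType) (n : nat) (hn : (1 <= n)%N)
    (c : UR_lt R n) :
  injective (pi1_map R (UR_lt_incl R n) c).
Proof.
have kernel a : pi1_map R (UR_lt_incl R n) c a = 1%g -> a = 1%g.
  elim/quotW: a => p; rewrite pi1_mapE => /pi1_eqP /null_homotopic_UR_lt hp.
  exact/pi1_eqP.
move=> a b ab.
have : (a * b^-1)%g = 1%g.
  by apply: kernel; rewrite pi1_mapM ab -pi1_mapM mulgV pi1_map1.
by move=> /(congr1 (fun g => g * b)%g); rewrite -mulgA mulVg mulg1 mul1g.
Qed.
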